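(* 1) For any irrational circle rotation $R_{L,M}$ and any union of arcs $\Gamma$ on the circle $\mathbb{R}/L\mathbb{Z}$, the first return map for $R_{L,M}$ onto $\Gamma$ is an irreducible rotational interval exchange (this holds for every admissible choice of the projection point $x_0$). 2) For any irreducible rotational interval exchange $(\sigma,\mathbf{x})$, there exist a circle rotation $R_{L,M}$ and a union of arcs $\Gamma$ such that the first return map for $R_{L,M}$ onto $\Gamma$ is an interval exchange shift equivalent to $(\sigma,\mathbf{x})$. 3) An irreducible interval exchange scheme $\sigma$ is rotational if and only if there exist an irrational circle rotation $R_{L,M}$ and a union of arcs $\Gamma$ such that the first return map for $R_{L,M}$ onto $\Gamma$ is an interval exchange with scheme $\sigma$.
   Context: **Schemes and IREs.** Let $\mathcal{A}$ be a finite alphabet of $d\ge 1$ symbols and $\bar{\mathcal{A}}=\mathcal{A}\times\{\mathrm{b},\mathrm{e}\}$ the doubled alphabet; write $\alpha\mathrm{b}=(\alpha,\mathrm{b})$, $\alpha\mathrm{e}=(\alpha,\mathrm{e})$. An interval rearrangement ensemble (IRE) scheme is any permutation $\sigma$ of $\bar{\mathcal{A}}$. A vector $\mathbf{x}\in\mathbb{R}^{\bar{\mathcal{A}}}$ is a vector of endpoints allowed by $\sigma$ if $x_{\sigma(\alpha\mathrm{b})}-x_{\alpha\mathrm{b}}=x_{\alpha\mathrm{e}}-x_{\sigma(\alpha\mathrm{e})}$ for all $\alpha\in\mathcal{A}$; then $(\sigma,\mathbf{x})$ is called an IRE, and its vector of lengths $\mathbf{v}\in\mathbb{R}^{\mathcal{A}}$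 is $v_\alpha=x_{\sigma(\alpha\mathrm{b})}-x_{\alpha\mathrm{b}}=x_{\alpha\mathrm{e}}-x_{\sigma(\alpha\mathrm{e})}$. A vector $\mathbf{v}$ is allowed by $\sigma$ if it is the vector of lengths of some IRE $(\sigma,\mathbf{x})$. Two IREs are shift equivalent if they have the same scheme and the same vector of lengths. An IRE is positive if all its lengths are positive; a scheme is positive if it allows a positive vector of lengths. **Irreducibility.** A scheme $\sigma$ is irreducible if $\sigma(\mathcal{A}_0\times\{\mathrm{b},\mathrm{e}\})=\mathcal{A}_0\times\{\mathrm{b},\mathrm{e}\}$ with $\mathcal{A}_0\subset\mathcal{A}$ implies $\mathcal{A}_0\in\{\varnothing,\mathcal{A}\}$. An IRE is irreducible if its scheme is. **Interval exchanges.** An interval exchange scheme is a positive scheme $\sigma$ every cycle of which, as a permutation, has the form $(\alpha_1\mathrm{b},\dots,\alpha_m\mathrm{b},\beta_n\mathrm{e},\dots,\beta_1\mathrm{e})$ with $m,n\ge 1$ (each element is mapped by $\sigma$ to the next one, the last to the first). An interval exchange is a positive IRE $(\sigma,\mathbf{x})$ with such a scheme. Its beginning intervals are $I_{\alpha\mathrm{b}}=[x_{\alpha\mathrm{b}},x_{\sigma(\alpha\mathrm{b})})$ and its ending intervals are $I_{\alpha\mathrm{e}}=[x_{\sigma(\alpha\mathrm{e})},x_{\alpha\mathrm{e}})$. To a cycle $(\alpha_1\mathrm{b},\dots,\alpha_m\mathrm{b},\beta_n\mathrm{e},\dots,\beta_1\mathrm{e})$ of $\sigma$ corresponds the segment $J=[x_{\alpha_1\mathrm{b}},x_{\beta_n\mathrm{e}})=\bigcup_i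 I_{\alpha_i\mathrm{b}}=\bigcup_j I_{\beta_j\mathrm{e}}$. The associated mapping acts on the disjoint union of these segments and shifts each $I_{\alpha\mathrm{b}}$ onto $I_{\alpha\mathrm{e}}$ by translation. **Duality and rotational schemes.** The dual $\sigma^*$ of a scheme $\sigma$ is the scheme with $\sigma^*(\alpha\mathrm{b})=\sigma(\alpha\mathrm{e})$, $\sigma^*(\alpha\mathrm{e})=\sigma(\alpha\mathrm{b})$ for all $\alpha\in\mathcal{A}$. An interval exchange scheme is rotational if its dual is also an interval exchange scheme. A rotational interval exchange is an interval exchange with a rotational scheme. **Circle rotations and first return maps.** For $L>0$, $M\in\mathbb{R}$, the circle rotation is $R_{L,M}:a\mapsto a+M$ on $\mathbb{R}/L\mathbb{Z}$; it is irrational if $M/L\notin\mathbb{Q}$. An arc is a (non-empty) half-open (left-closed, right-open) segment on the circle; a union of arcs means a non-empty union of finitely many arcs. For $f:X\to X$ and $\Gamma\subset X$ such that every point of $\Gamma$ returns to $\Gamma$ in positive time, the first return map is $f_\Gamma(x)=f^{n}(x)$, where $n\ge1$ is the smallest positive integer with $f^n(x)\in\Gamma$. The circle is identified with a half-open segment $[x_0,x_0+L)$, so that a union of arcs $\Gamma$ becomes a finite union of half-open real segments, and one considers the maximal such segments (overlapping or touching arcs are united into one). If $\Gamma$ is not the whole circle, $x_0$ is chosen (admissible choice) to project to a point not in the interior of any of the maximal arcs of $\Gamma$; if $\Gamma$ is the whole circle, $x_0$ is arbitrary and $\Gamma$ is interpreted as the single segment $[x_0,x_0+L)$. The first return map $f_\Gamma$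 ''is an interval exchange $(\sigma,\mathbf{x})$'' if $(\sigma,\mathbf{x})$ is an interval exchange whose segments (one for each cycle of $\sigma$) are exactly the maximal segments of $\Gamma$ and whose associated mapping is $f_\Gamma$; it ''is a (rotational, irreducible) interval exchange'', or ''is an interval exchange with scheme $\sigma$'', if this holds for some such $(\sigma,\mathbf{x})$. *)

(* Defs.v *)
From HB Require Import structures.
From mathcomp Require Import all_boot all_order all_algebra all_fingroup.
From mathcomp Require Import generic_quotient ring_quotient.
From mathcomp Require Import all_classical all_reals all_analysis.

Set Implicit Arguments.
Unset Strict Implicit.
Unset Printing Implicit Defensive.

Import Order.TTheory GRing.Theory Num.Theory.
Import numFieldNormedType.Exports.

Local Open Scope classical_set_scope.
Local Open Scope ring_scope.
Local Open Scope quotient_scope.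

(* In the doubled alphabet, [false] marks beginnings and [true] endings. *)
Notation doubled A := (A * bool)%type.
Definition bg (A : Type) (a : A) : doubled A := (a, false).
Definition en (A : Type) (a : A) : doubled A := (a, true).

Section Schemes.
Context (A : finType).
Implicit Types (sigma : {perm doubled A}) (a : A).

Definition irreducible_scheme sigma : Prop :=
  forall A0 : {set A},
    (sigma @: finset.setX A0 [set: bool])%SET = finset.setX A0 [set: bool]%SET ->
    A0 = finset.set0 \/ A0 = [set: A]%SET.

Lemma swap_ends_inj : injective (fun p : doubled A => (p.1, ~~ p.2)).
Proof. by move=> [a b] [c d] /= [-> /negb_inj ->]. Qed.

Definition swap_ends : {perm doubled A} := perm swap_ends_inj.

(* In [{perm _}], [(s * t) p = t (s p)]. *)
Definition dual sigma : {perm doubled A} := (swap_ends * sigma)%g.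

Lemma dual_bg sigma a : dual sigma (bg a) = sigma (en a).
Proof. by rewrite permM permE. Qed.

Lemma dual_en sigma a : dual sigma (en a) = sigma (bg a).
Proof. by rewrite permM permE. Qed.

(* [C] is a cycle (a1 b, ..., am b, bn e, ..., b1 e), with m, n >= 1, where    *)
(* a1 = [a] and bn = [b]: the two letters giving the ends of its segment.     *)
Definition exchange_cycle sigma (C : {set doubled A}) (a b : A) : Prop :=
  exists s t : seq A,
    let c := map (@bg A) (a :: s) ++ map (@en A) (b :: t) in
    ufcycle sigma c /\ C = [set p in c]%SET.

End Schemes.

Section Ensembles.
Context (R : realType) (A : finType).
Implicit Types (sigma : {perm doubled A}) (x : {ffun doubled A -> R}).

Definition allowed_endpoints sigma x : Prop :=
  forall a, x (sigma (bg a)) - x (bg a) = x (en a) - x (sigma (en a)).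

Definition lengths sigma x : {ffun A -> R} :=
  [ffun a => x (sigma (bg a)) - x (bg a)].

Definition allowed_lengths sigma (v : {ffun A -> R}) : Prop :=
  exists x, allowed_endpoints sigma x /\ lengths sigma x = v.

Definition shift_equivalent sigma x sigma' x' : Prop :=
  sigma = sigma' /\ lengths sigma x = lengths sigma' x'.

Definition positive_scheme sigma : Prop :=
  exists v : {ffun A -> R}, allowed_lengths sigma v /\ forall a, 0 < v a.

Definition exchange_scheme sigma : Prop :=
  positive_scheme sigma /\
  forall C, C \in porbits sigma -> exists a b, exchange_cycle sigma C a b.

Definition rotational_scheme sigma : Prop :=
  exchange_scheme sigma /\ exchange_scheme (dual sigma).

Definition interval_exchange sigma x : Prop :=
  [/\ exchange_scheme sigma, allowed_endpoints sigma x
    & forall a, 0 < lengths sigma x a].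

Definition beginning_interval sigma x (a : A) : set R :=
  `[x (bg a), x (sigma (bg a))[.

Definition ending_interval sigma x (a : A) : set R :=
  `[x (sigma (en a)), x (en a)[.

Definition exchange_segment sigma x (C : {set doubled A}) (J : set R) : Prop :=
  exists a b, exchange_cycle sigma C a b /\ J = `[x (bg a), x (en b)[%classic.

(* The graph of the mapping associated with an interval exchange, on the real *)
(* line.  It represents the mapping on the disjoint union of the segments     *)
(* when these are pairwise disjoint in [R], as in [first_return_is_exchange]. *)
Definition exchange_graph sigma x (y z : R) : Prop :=
  exists a, [/\ beginning_interval sigma x a y, ending_interval sigma x a z
    & z - x (sigma (en a)) = y - x (bg a)].

End Ensembles.

Section Maximal.
Context (T : Type).

Definition maximal_in (P : set T -> Prop) (X S : set T) : Prop :=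
  [/\ P S, S `<=` X
    & forall S', P S' -> S' `<=` X -> S `<=` S' -> S' = S].

End Maximal.

Section FirstReturn.
Context (X : Type) (f : X -> X) (G : set X).

Definition returns_at (x : X) (n : nat) : bool :=
  (0 < n)%N && `[< G (iter n f x) >].

Definition recurrent : Prop := forall x, G x -> exists n, returns_at x n.

(* [f] iterated [0] times, i.e. the identity, at points that never return. *)
Definition first_return_map (x : X) : X :=
  if pselect (exists n, returns_at x n) is left h then iter (ex_minn h) f x
  else x.

End FirstReturn.

Definition multiples (R : realType) (L : R) : {pred R} :=
  fun z => `[< exists k : int, z = k%:~R * L >].

Lemma multiples_zmod_closed (R : realType) (L : R) : zmod_closed (multiples L).
Proof.
split=> [|y z]; first by apply/asboolP; exists 0; rewrite mul0r.
move=> /asboolP[k ->] /asboolP[l ->]; apply/asboolP; exists (k - l).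
by rewrite intrB mulrBl.
Qed.

HB.instance Definition _ (R : realType) (L : R) :=
  GRing.isZmodClosed.Build R (multiples L) (multiples_zmod_closed L).

Definition circle (R : realType) (L : R) : Type := Quotient.quot (multiples L).

HB.instance Definition _ (R : realType) (L : R) :=
  GRing.Zmodule.copy (circle L) (Quotient.quot (multiples L)).
HB.instance Definition _ (R : realType) (L : R) :=
  EqQuotient.copy (circle L) (Quotient.quot (multiples L)).

Section Circle.
Context (R : realType) (L : R).
Implicit Types (Gamma S : set (circle L)).

Definition circle_pi (a : R) : circle L := \pi_(circle L) a.

Definition rotation (M : R) (p : circle L) : circle L := p + circle_pi M.

Definition circle_arc S : Prop :=
  exists a b : R, [/\ a < b, b <= a + L & S = circle_pi @` `[a, b[].

Definition union_of_arcs Gamma : Prop :=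
  exists (n : nat) (S : 'I_n.+1 -> set (circle L)),
    (forall i, circle_arc (S i)) /\ Gamma = \bigcup_i S i.

(* The quotient topology on [circle L] serves only for the interior of [S]. *)
Definition admissible Gamma (x0 : R) : Prop :=
  Gamma <> setT -> forall S, maximal_in circle_arc Gamma S ->
    ~ interior (S : set (quotient_topology (circle L))) (circle_pi x0).

Definition unroll Gamma (x0 : R) : set R :=
  `[x0, x0 + L[ `&` circle_pi @^-1` Gamma.

Definition half_open (J : set R) : Prop :=
  exists a b : R, a < b /\ J = `[a, b[%classic.

(* The first return map for the rotation by [M] onto [Gamma], with the circle *)
(* identified with [x0, x0 + L), is the interval exchange [(sigma, x)].       *)
Definition first_return_is_exchange (M : R) Gamma (x0 : R) (A : finType)
    (sigma : {perm doubled A}) (x : {ffun doubled A -> R}) : Prop :=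
  [/\ interval_exchange sigma x,
      recurrent (rotation M) Gamma,
      (forall C J, exchange_segment sigma x C J ->
         maximal_in half_open (unroll Gamma x0) J),
      (forall J, maximal_in half_open (unroll Gamma x0) J ->
         exists! C, exchange_segment sigma x C J)
    & forall y z, unroll Gamma x0 y -> unroll Gamma x0 z ->
        exchange_graph sigma x y z <->
        first_return_map (rotation M) Gamma (circle_pi y) = circle_pi z].

End Circle.

(* Main.v *)
Require Import Defs.
From HB Require Import structures.
From mathcomp Require Import all_boot all_order all_algebra all_fingroup.
From mathcomp Require Import generic_quotient ring_quotient.
From mathcomp Require Import all_classical all_reals all_analysis.
From mathcomp Require Import ring lra.

Set Implicit Arguments.
Unset Strict Implicit.
Unset Printing Implicit Defensive.

Import Order.TTheory GRing.Theory Num.Theory.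
Import numFieldNormedType.Exports.

(** The endpoints allowed by a scheme [sigma] satisfy
    [x (sigma (bg a)) + x (sigma (en a)) = x (bg a) + x (en a)] for all
    letters [a], an equation in which [sigma] and its dual play the same role.
    It is the cocycle condition on the surface glued from one quadrilateral per
    letter, whose vertices are the cycles of [sigma] and of its dual and whose
    edges are the elements of the doubled alphabet. The lengths of [x] for
    [sigma] are its increments along the cycles of [sigma] ([width]), the
    lengths for the dual are its increments along the cycles of the dual
    ([height]), and functions constant on cycles are the coboundaries. The sum
    [pairing x y] of the products of widths of [x] and heights of [y] is the
    cup product, the area of the suspension of an exchange with widths from
    [x] and return times from [y].

    If [sigma] and its dual are both exchange schemes, every cycle turns once,
    there are as many cycles as letters, and the surface, connected by
    irreducibility, is a torus. So the first cohomology is a plane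
    ([cochain_span]), and Poincare duality on loops shows that the cup product
    is unimodular on integral classes ([integer_periods]). Positivity of the
    dual then yields an integral cocycle [h] with positive heights, and an
    integral [h'] with [pairing h' h = 1] ([closed_heights]); every cocycle with positive widths is
    [x = L * h' + M * h] up to coboundaries, with [L = pairing x h] positive.
    Modulo [L] the endpoints are thus [M * h], up to moving the segments: over
    each letter stands a tower of [height h a] translates of its interval by
    multiples of [M], and a telescoping sum of floors shows that these storeys
    cover the circle of length [L] exactly once ([tower_count]). Hence the
    first return of the rotation by [M] to the ground floor is the given
    exchange ([embedded_exchange]); choosing [h] so that no left end and right
    end of segments have equal heights keeps the segments from touching. Adding
    a small multiple of [h] to [x] changes [M] and not [L], so that [M / L] can
    be made irrational.

    Conversely, let the rotation be irrational. Cutting the arcs at the points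
    that reach an end of an arc before they return gives finitely many pieces,
    and the pieces and their images are two partitions of the arcs; reading the
    successive ends in both partitions defines the scheme
    ([exchange_of_partitions], [first_return_of_arcs]). In any exchange that is
    a first return of the rotation, the translation lengths determine the
    return times, so each letter has a constant return time, and the points of
    a cycle of the dual have integral positions on one orbit of the rotation.
    Beginnings move up this orbit and endings move down, and no level is
    crossed downwards twice, because two such letters would meet before their
    first return. A cycle with these properties consists of beginnings followed
    by endings ([exchange_cycle_of_levels]), which makes the dual an exchange
    scheme ([dual_exchange_scheme]). Irreducibility holds because orbits are
    dense ([return_exchange_irreducible]). *)

Local Open Scope ring_scope.

(** * Cochains on the quadrangulation of a scheme *)

Section Cochains.
Context (A : finType) (sigma : {perm doubled A}).

(** A scheme glues one quadrilateral per letter into a surface whose vertices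
    are the cycles of [sigma] and of its dual, and whose edges are the elements
    of the doubled alphabet, each joining its two cycles. Around the face of
    [a] the edges [bg a], [sigma (bg a)], [en a], [sigma (en a)] alternate in
    direction, so this is the cocycle condition; it is also the condition on
    endpoints, for [sigma] and for its dual alike. *)
Definition closed_cochain (T : comNzRingType) (x : doubled A -> T) : Prop :=
  forall a, x (sigma (bg a)) + x (sigma (en a)) = x (bg a) + x (en a).

Definition width (T : comNzRingType) (x : doubled A -> T) (a : A) : T :=
  x (sigma (bg a)) - x (bg a).

(** The length of the letter [a] for the dual scheme. *)
Definition height (T : comNzRingType) (x : doubled A -> T) (a : A) : T :=
  x (sigma (en a)) - x (bg a).

(** Functions constant on the cycles of [sigma], or on those of the dual, are
    the coboundaries: they move the segments without changing lengths. *)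
Definition invariant_under (S : Type) (s : {perm doubled A})
  (f : doubled A -> S) : Prop := forall p, f (s p) = f p.

(** The cup product: the area of the union of the rectangles with sides
    [width x a] and [height y a]. *)
Definition pairing (T : comNzRingType) (x y : doubled A -> T) : T :=
  \sum_a width x a * height y a.

Lemma big_doubled (T : comNzRingType) (F : doubled A -> T) :
  \sum_p F p = \sum_a (F (bg a) + F (en a)).
Proof.
transitivity (\sum_(a : A) \sum_(b : bool) F (a, b)).
  by rewrite pair_bigA /=; apply: eq_bigr => -[].
by apply: eq_bigr => a _; rewrite big_bool addrC.
Qed.

Lemma sum_perm (T : comNzRingType) (s : {perm doubled A}) (F : doubled A -> T) :
  \sum_p F (s p) = \sum_p F p.
Proof. by rewrite [RHS](reindex_inj (@perm_inj _ s)). Qed.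

Lemma closed_heightE (T : comNzRingType) (x : doubled A -> T) a :
  closed_cochain x -> height x a = x (en a) - x (sigma (bg a)).
Proof.
by move=> xc; apply: (addrI (x (sigma (bg a)))); rewrite /height addrA xc; ring.
Qed.

Lemma closed_widthE (T : comNzRingType) (x : doubled A -> T) a :
  closed_cochain x -> width x a = x (en a) - x (sigma (en a)).
Proof.
by move=> xc; apply: (addIr (x (sigma (en a)))); rewrite /width addrAC xc; ring.
Qed.

Lemma closedB (T : comNzRingType) (x y : doubled A -> T) :
  closed_cochain x -> closed_cochain y -> closed_cochain (x \- y).
Proof. by move=> xc yc a /=; rewrite addrACA -opprD xc yc opprD addrACA. Qed.

Lemma closedD (T : comNzRingType) (x y : doubled A -> T) :
  closed_cochain x -> closed_cochain y -> closed_cochain (x \+ y).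
Proof. by move=> xc yc a /=; rewrite addrACA xc yc addrACA. Qed.

Lemma closedZ (T : comNzRingType) (c : T) (x : doubled A -> T) :
  closed_cochain x -> closed_cochain (fun p => c * x p).
Proof. by move=> xc a; rewrite -!mulrDr xc. Qed.

Lemma invariant_closed (T : comNzRingType) (f : doubled A -> T) :
  invariant_under sigma f -> closed_cochain f.
Proof. by move=> fs a; rewrite !fs. Qed.

Lemma dual_invariant_closed (T : comNzRingType) (f : doubled A -> T) :
  invariant_under (dual sigma) f -> closed_cochain f.
Proof. by move=> fs a; rewrite -dual_bg -dual_en !fs addrC. Qed.

(** Both sides are polarizations of the quadratic form
    [x (sigma b) * x (sigma e) - x b * x e]. *)
Lemma pairing_antisym (T : comNzRingType) (x y : doubled A -> T) :
  closed_cochain x -> closed_cochain y -> pairing x y = - pairing y x.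
Proof.
move=> xc yc; apply/eqP; rewrite -addr_eq0; apply/eqP.
have E : \sum_p x p * y p - \sum_p x (sigma p) * y (sigma p) = 0.
  by rewrite (sum_perm sigma (fun p => x p * y p)) subrr.
rewrite -[RHS]E !big_doubled /pairing -!big_split -sumrB; apply: eq_bigr => a _.
have := xc a; have := yc a; rewrite /width /height /=.
set yb := y (bg a); set ye := y (en a); set xb := x (bg a).
set xe := x (en a); set xB := x _; set xE := x _; set yB := y _; set yE := y _.
move=> /(canRL (addrK _)) -> /(canRL (addrK _)) ->; ring.
Qed.

Lemma pairing_self (T : numDomainType) (x : doubled A -> T) :
  closed_cochain x -> pairing x x = 0.
Proof.
move=> xc; have /eqP := pairing_antisym xc xc.
by rewrite -subr_eq0 opprK -mulr2n mulrn_eq0 => /eqP.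
Qed.

Lemma pairing_invl (T : comNzRingType) (f y : doubled A -> T) :
  invariant_under sigma f -> pairing f y = 0.
Proof.
by move=> fs; rewrite /pairing big1// => a _; rewrite /width fs subrr mul0r.
Qed.

Lemma pairing_dual_invr (T : comNzRingType) (x f : doubled A -> T) :
  invariant_under (dual sigma) f -> pairing x f = 0.
Proof.
by move=> fs; rewrite /pairing big1// => a _; rewrite /height -dual_bg fs subrr mulr0.
Qed.

Lemma pairing_invr (T : comNzRingType) (x f : doubled A -> T) :
  closed_cochain x -> invariant_under sigma f -> pairing x f = 0.
Proof.
move=> xc fs; rewrite pairing_antisym ?pairing_invl ?oppr0//.
exact: invariant_closed.
Qed.

Lemma pairing_dual_invl (T : comNzRingType) (f y : doubled A -> T) :
  closed_cochain y -> invariant_under (dual sigma) f -> pairing f y = 0.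
Proof.
move=> yc fs; rewrite pairing_antisym ?pairing_dual_invr ?oppr0//.
exact: dual_invariant_closed.
Qed.

Lemma pairingDl (T : comNzRingType) (x x' y : doubled A -> T) :
  pairing (x \+ x') y = pairing x y + pairing x' y.
Proof.
by rewrite /pairing -big_split;
   apply: eq_bigr => a _; rewrite /width /=; ring.
Qed.

Lemma pairingDr (T : comNzRingType) (x y y' : doubled A -> T) :
  pairing x (y \+ y') = pairing x y + pairing x y'.
Proof.
by rewrite /pairing -big_split;
   apply: eq_bigr => a _; rewrite /height /=; ring.
Qed.

Lemma pairingZl (T : comNzRingType) c (x y : doubled A -> T) :
  pairing (fun p => c * x p) y = c * pairing x y.
Proof.
by rewrite /pairing mulr_sumr;
   apply: eq_bigr => a _; rewrite /width; ring.
Qed.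

Lemma pairingZr (T : comNzRingType) c (x y : doubled A -> T) :
  pairing x (fun p => c * y p) = c * pairing x y.
Proof.
by rewrite /pairing mulr_sumr;
   apply: eq_bigr => a _; rewrite /height; ring.
Qed.

Lemma pairing_ext (T : comNzRingType) (x x' y y' : doubled A -> T) :
  x =1 x' -> y =1 y' -> pairing x y = pairing x' y'.
Proof. by move=> xx' yy'; apply: eq_bigr => a _; rewrite /width /height !xx' !yy'. Qed.

Lemma closed_ext (T : comNzRingType) (x x' : doubled A -> T) :
  x =1 x' -> closed_cochain x -> closed_cochain x'.
Proof. by move=> e xc a; rewrite -!e xc. Qed.

(** Poincare duality, from loops to cocycles: let [z p] be the common value
    of the two differences, so that [z] sums to zero over all cycles and is a
    loop in the graph. Its two primitives, around the cycles of [sigma] and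
    around those of the dual, differ by the cocycle that counts the crossings
    of a curve with this loop. *)
Lemma primitive_gap_closed (T : comNzRingType) (f g : doubled A -> T) :
  (forall p, f (sigma p) - f p = g (dual sigma p) - g p) ->
  closed_cochain (f \- g).
Proof.
move=> fg a /=; have := fg (en a); have := fg (bg a).
rewrite dual_bg dual_en => /(canRL (subrK _)) -> /(canRL (subrK _)) ->; ring.
Qed.

(** Summation by parts along the cycles of the dual. *)
Lemma pairing_primitive_gap (T : comNzRingType) (f g y : doubled A -> T) :
  (forall p, f (sigma p) - f p = g (dual sigma p) - g p) -> closed_cochain y ->
  pairing (f \- g) y = - \sum_p (f (sigma p) - f p) * y p.
Proof.
move=> fg yc; pose s := dual sigma.
transitivity (\sum_p (f (sigma p) - f p) * (y (s p) - y p)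
              + \sum_p g p * (y (s p) - y p)).
  rewrite -big_split big_doubled; apply: eq_bigr => a _ /=.
  rewrite !(dual_bg, dual_en) /width /=.
  have -> : y (sigma (bg a)) - y (en a) = - (y (sigma (en a)) - y (bg a)).
    by rewrite -/(height y a) closed_heightE// opprB.
  rewrite -/(height y a); have := fg (bg a); have := fg (en a).
  rewrite dual_bg dual_en => /(canRL (subrK _)) E1 /(canRL (subrK _)) E2.
  rewrite E1 E2; ring.
have -> : \sum_p g p * (y (s p) - y p) = - \sum_p (f (sigma p) - f p) * y (s p).
  under eq_bigr do rewrite mulrBr.
  rewrite sumrB -(sum_perm s (fun p => g p * y p)) -sumrB -sumrN.
  by apply: eq_bigr => p _; rewrite fg -/s; ring.
by rewrite -sumrB -sumrN; apply: eq_bigr => p _; ring.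
Qed.

(** An invariant of both permutations takes one value on the two ends of a
    letter, so its level sets are invariant families of letters. *)
Lemma irreducible_invariant (S : eqType) (f : doubled A -> S) :
  irreducible_scheme sigma -> invariant_under sigma f ->
  invariant_under (dual sigma) f -> forall p q, f p = f q.
Proof.
move=> irr fs fd.
have fe a b : f (a, b) = f (bg a).
  by case: b => //; rewrite -[RHS]fd dual_bg fs.
move=> [a0 b0] [a1 b1]; rewrite !fe.
pose A0 := [set a | f (bg a) == f (bg a0)]%SET.
case: (irr A0) => [|A0e|A0e].
- apply/eqP; rewrite eqEcard card_imset ?leqnn ?andbT; last exact: perm_inj.
  apply/fintype.subsetP => p /imsetP[[a b] /setXP[]]; rewrite inE => /eqP fa _ ->.
  case E: (sigma (a, b)) => [a' b'].
  by rewrite finset.in_setX !inE andbT -(fe a' b') -E fs fe fa.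
- have : a0 \in A0 by rewrite inE.
  by rewrite A0e inE.
- have : a1 \in A0 by rewrite A0e inE.
  by rewrite inE => /eqP.
Qed.

End Cochains.

(** * Integer periods *)

Lemma int_subgroup_generator (P : int -> Prop) :
  P 0 -> (forall m n, P m -> P n -> P (m - n)) ->
  exists2 g, P g & forall n, P n -> (g %| n)%Z.
Proof.
move=> P0 PB; have PN n : P n -> P (- n) by move=> /(PB _ _ P0); rewrite sub0r.
have PD m n : P m -> P n -> P (m + n).
  by move=> Pm /PN /(PB _ _ Pm); rewrite opprK.
have Pnat n (k : nat) : P n -> P (n * k).
  by move=> Pn; elim: k => [|k IH]; rewrite ?mulr0// intS mulrDr mulr1; exact: PD.
have PM n k : P n -> P (n * k).
  by case: k => k Pn; [exact: Pnat|rewrite NegzE mulrN; apply/PN/Pnat].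
have Pabs n : P n -> P `|n|%N.
  by move=> Pn; rewrite abszE; case: (ger0P n) => // _; exact: PN.
case: (pselect (exists n : nat, (0 < n)%N && `[< P n >])) => [ex|nex].
  case: (ex_minnP ex) => g /andP[g0 /asboolP Pg] gmin; exists g => // n Pn.
  have Pr : P (n %% g)%Z.
    by rewrite /modz mulrC; apply: PB => //; exact: PM.
  apply/dvdz_mod0P/eqP; apply: contraT => r0.
  have g0' : (g : int) != 0 by rewrite eqz_nat -lt0n.
  have := gmin `|(n %% g)%Z|%N; rewrite absz_gt0 r0 /=.
  have := Pabs _ Pr => /asboolP -> /(_ isT).
  by rewrite leqNgt -ltz_nat gez0_abs ?modz_ge0// ltz_pmod ?ltz_nat.
exists 0 => // n Pn; rewrite dvd0z; apply: contraT => n0; case: nex.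
by exists `|n|%N; rewrite absz_gt0 n0; apply/asboolP; exact: Pabs.
Qed.

Section Periods.
Context (A : finType) (sigma : {perm doubled A}).
Hypothesis irr : irreducible_scheme sigma.

Let delta (p q : doubled A) : int := (q == p)%:R.

(** [z] is a loop of the graph, witnessed by its primitives around the two
    kinds of vertices. *)
Definition loop_primitives (z f g : doubled A -> int) : Prop :=
  forall p, z p = f (sigma p) - f p /\ z p = g (dual sigma p) - g p.

(** The boundary of the chain [z] is the [sigma]-cycle of [q] minus that of
    [p]; boundaries are compared up to functions with a primitive, so that no
    representatives of the cycles have to be chosen. *)
Definition joining_chain (p q : doubled A) (z : doubled A -> int) : Prop :=
  exists f g, forall r, z r = delta q r - delta p r + (f (sigma r) - f r)
                   /\ z r = g (dual sigma r) - g r.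

(** The edges joined to [p] form a set invariant under [sigma] and its dual;
    irreducibility is the connectedness of the graph. *)
Lemma joining_chain_exists p q : exists z, joining_chain p q z.
Proof.
have refl p' : exists z, joining_chain p' p' z.
  by exists (fun=> 0), (fun=> 0), (fun=> 0) => r; split; ring.
have ext r r' : (exists z, joining_chain r r' z) ->
    (exists z, joining_chain p r z) <-> (exists z, joining_chain p r' z).
  move=> [z [f [g zP]]]; split=> -[z1 [f1 [g1 z1P]]].
    exists (z1 \+ z), (f1 \+ f), (g1 \+ g) => t.
    by have [zf zg] := zP t; have [z1f z1g] := z1P t; split => /=;
      [rewrite z1f zf|rewrite z1g zg]; ring.
  exists (z1 \- z), (f1 \- f), (g1 \- g) => t.
  by have [zf zg] := zP t; have [z1f z1g] := z1P t; split => /=;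
    [rewrite z1f zf|rewrite z1g zg]; ring.
apply/asboolP; pose S r := `[< exists z, joining_chain p r z >].
rewrite -/(S q) (irreducible_invariant (f := S) irr _ _ q p); first exact/asboolP.
- move=> r; apply: asbool_equiv_eq; apply: iff_sym; apply: ext.
  exists (fun=> 0), (delta (sigma r)), (fun=> 0) => t; split; last by ring.
  by rewrite /delta (inj_eq perm_inj); ring.
- move=> r; apply: asbool_equiv_eq; apply: iff_sym; apply: ext.
  exists (fun t => delta (dual sigma r) t - delta r t), (fun=> 0).
  exists (fun t => - delta (dual sigma r) t) => t; split; first by ring.
  by rewrite /delta (inj_eq perm_inj); ring.
Qed.

Lemma sum_delta (y : doubled A -> int) p : \sum_q delta p q * y q = y p.
Proof.
rewrite (bigD1 p)//= /delta eqxx mul1r big1 ?addr0// => q /negbTE ->.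
by rewrite mul0r.
Qed.

(** The periods of [y] along loops form a subgroup of the integers, with
    generator [g], and [u] is dual to a loop of period [g]. Modulo [g] all
    periods vanish, so integrating [y] along joining chains gives a potential
    on the vertices, which is the sum of [f] and [k]. *)
Lemma integer_periods (y : doubled A -> int) : closed_cochain sigma y ->
  exists g u f k y',
    [/\ closed_cochain sigma u, pairing sigma y u = g,
        invariant_under sigma f, invariant_under (dual sigma) k
      & forall p, y p = g * y' p + f p + k p].
Proof.
move=> yc.
pose P n := exists z f k, loop_primitives z f k /\ \sum_p z p * y p = n.
have [|m n [z [f [k [zP <-]]]] [z1 [f1 [k1 [z1P <-]]]]|g gP gdvd] :=
    @int_subgroup_generator P.
- exists (fun=> 0), (fun=> 0), (fun=> 0); split; first by move=> p; rewrite subrr.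
  by rewrite big1// => p _; rewrite mul0r.
- exists (z \- z1), (f \- f1), (k \- k1); split.
    move=> t /=; have [zf zg] := zP t; have [z1f z1g] := z1P t.
    by split; [rewrite z1f zf|rewrite z1g zg]; ring.
  by rewrite -sumrB; apply: eq_bigr => p _; rewrite mulrBl.
have [u uc yu] : exists2 u, closed_cochain sigma u & pairing sigma y u = g.
  have [z [f [k [zP <-]]]] := gP.
  have fk p : f (sigma p) - f p = k (dual sigma p) - k p.
    by have [<- <-] := zP p.
  have uc := primitive_gap_closed fk.
  exists (f \- k) => //; rewrite pairing_antisym// pairing_primitive_gap// opprK.
  by apply: eq_bigr => p _; have [->] := zP p.
case: (pickP (fun _ : doubled A => true)) => [p0 _|nop]; last first.
  by exists g, u, (fun=> 0), (fun=> 0), (fun=> 0); split=> // p; have := nop p.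
have /choice[z zP] := joining_chain_exists p0.
pose a p := \sum_q z p q * y q.
have as_ p : (g %| a (sigma p) - a p)%Z.
  have [f [k fkP]] := zP p; have [f1 [k1 fk1P]] := zP (sigma p).
  apply: gdvd; exists (z (sigma p) \- z p).
  exists (fun r => f1 r - f r - delta (sigma p) r), (k1 \- k); split.
    move=> r /=; have [Ef Ek] := fkP r; have [Ef1 Ek1] := fk1P r.
    split; [rewrite Ef1 Ef|rewrite Ek1 Ek]; rewrite /delta ?(inj_eq perm_inj); ring.
  by rewrite -sumrB; apply: eq_bigr => q _; rewrite mulrBl.
have bs p : (g %| (y (dual sigma p) - a (dual sigma p)) - (y p - a p))%Z.
  have [f [k fkP]] := zP p; have [f1 [k1 fk1P]] := zP (dual sigma p).
  apply: gdvd; exists (fun r => z p r - z (dual sigma p) r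
                             + (delta (dual sigma p) r - delta p r)).
  exists (f \- f1), (fun r => k r - k1 r - delta (dual sigma p) r); split.
    move=> r /=; have [Ef Ek] := fkP r; have [Ef1 Ek1] := fk1P r.
    split; [rewrite Ef1 Ef|rewrite Ek1 Ek]; rewrite /delta ?(inj_eq perm_inj); ring.
  under eq_bigr do rewrite mulrDl !mulrBl.
  rewrite big_split !sumrB /= -/(a p) -/(a (dual sigma p)) !sum_delta; ring.
exists g, u, (fun p => (a p %% g)%Z), (fun p => ((y p - a p) %% g)%Z).
exists (fun p => ((a p %/ g)%Z + ((y p - a p) %/ g)%Z)); split=> // p.
- by apply/eqP; rewrite eqz_mod_dvd.
- by apply/eqP; rewrite eqz_mod_dvd.
have E1 := divz_eq (a p) g; have E2 := divz_eq (y p - a p) g.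
rewrite -[LHS](subrK (a p)) {1}E2 [X in _ + X = _]E1; ring.
Qed.

End Periods.

(** * Cycles of an exchange scheme *)

Lemma porbit_step (T : finType) (s : {perm T}) p : porbit s (s p) = porbit s p.
Proof. by rewrite -[RHS](porbit_perm s 1 p) expg1. Qed.

Section StepPaths.
Context (R : realType) (T : eqType) (f : T -> T) (x : T -> R).
Implicit Types (p q : T) (c : seq T) (u : R).

Lemma rising_path_ge p c q : path (frel f) p c ->
  {in p :: c, forall r, x r < x (f r)} -> q \in p :: c ->
  x p <= x q /\ x (f q) <= x (f (last p c)).
Proof.
elim: c p q => [|r c IH] p q /=; first by move=> _ _; rewrite inE => /eqP ->.
case/andP=> /eqP <- fc up.
have up' : {in f p :: c, forall r0, x r0 < x (f r0)}.
  by move=> r0 r0c; apply: up; rewrite inE r0c orbT.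
have [_ le0] := IH _ (f p) fc up' (mem_head _ _).
rewrite inE => /predU1P[->|/(IH _ _ fc up')[h1 h2]].
  split=> //; apply: le_trans le0; apply/ltW/up'; exact: mem_head.
by split=> //; apply: le_trans h1; apply/ltW/up; exact: mem_head.
Qed.

Lemma rising_path_cover p c u : path (frel f) p c ->
  x p <= u < x (f (last p c)) -> exists2 q, q \in p :: c & x q <= u < x (f q).
Proof.
elim: c p => [|r c IH] p /=; first by exists p; rewrite ?mem_head.
case/andP=> /eqP <- fc /andP[pu ul].
have [upf|fpu] := ltP u (x (f p)); first by exists p; rewrite ?mem_head ?pu.
have [|q qc qu] := IH (f p) fc; first by rewrite fpu.
by exists q; rewrite // inE qc orbT.
Qed.

Lemma rising_path_inj p c u q q' : path (frel f) p c ->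
  {in p :: c, forall r, x r < x (f r)} -> q \in p :: c -> q' \in p :: c ->
  x q <= u < x (f q) -> x q' <= u < x (f q') -> q = q'.
Proof.
elim: c p => [|r c IH] p /=; first by move=> _ _; rewrite !inE => /eqP -> /eqP ->.
case/andP=> /eqP <- fc up.
have up' : {in f p :: c, forall r0, x r0 < x (f r0)}.
  by move=> r0 r0c; apply: up; rewrite inE r0c orbT.
have excl r0 : r0 \in f p :: c -> x p <= u < x (f p) -> x r0 <= u -> False.
  move=> /(rising_path_ge fc up')[h _] /andP[_ up1] h'.
  by have := lt_le_trans up1 (le_trans h h'); rewrite ltxx.
rewrite inE => /predU1P[->|qc]; rewrite inE => /predU1P[->|q'c] //.
- by move=> hq /andP[hq' _]; case: (excl q').
- by move=> /andP[hq _] hq'; case: (excl q).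
- exact: IH up' qc q'c.
Qed.

Lemma falling_path_le p c q : path (frel f) p c ->
  {in p :: c, forall r, x (f r) < x r} -> q \in p :: c ->
  x q <= x p /\ x (f (last p c)) <= x (f q).
Proof.
elim: c p q => [|r c IH] p q /=; first by move=> _ _; rewrite inE => /eqP ->.
case/andP=> /eqP <- fc dn.
have dn' : {in f p :: c, forall r0, x (f r0) < x r0}.
  by move=> r0 r0c; apply: dn; rewrite inE r0c orbT.
have [_ le0] := IH _ (f p) fc dn' (mem_head _ _).
rewrite inE => /predU1P[->|/(IH _ _ fc dn')[h1 h2]].
  split=> //; apply: le_trans le0 _; apply/ltW/dn'; exact: mem_head.
by split=> //; apply: le_trans h1 _; apply/ltW/dn; exact: mem_head.
Qed.

Lemma falling_path_cover p c u : path (frel f) p c ->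
  x (f (last p c)) <= u < x p -> exists2 q, q \in p :: c & x (f q) <= u < x q.
Proof.
elim: c p => [|r c IH] p /=; first by exists p; rewrite ?mem_head.
case/andP=> /eqP <- fc /andP[pu ul].
have [upf|fpu] := leP (x (f p)) u; first by exists p; rewrite ?mem_head ?upf.
have [|q qc qu] := IH (f p) fc; first by rewrite fpu pu.
by exists q; rewrite // inE qc orbT.
Qed.

End StepPaths.

Section ExchangeCycles.
Context (A : finType) (sigma : {perm doubled A}).
Implicit Types (C : {set doubled A}) (a b : A).

Lemma bg_inj : injective (@bg A). Proof. by move=> a b []. Qed.

Lemma exchange_cycle_parts C a b : exchange_cycle sigma C a b ->
  exists s t : seq A,
    [/\ path (frel sigma) (bg a) (map (@bg A) s), sigma (bg (last a s)) = en b,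
        path (frel sigma) (en b) (map (@en A) t), sigma (en (last b t)) = bg a
      & C = porbit sigma (bg a) /\
        C = [set p in map (@bg A) (a :: s) ++ map (@en A) (b :: t)]%SET].
Proof.
move=> [s [t /= [/andP[cyc unq] CE]]]; exists s, t; move: (cyc) => /=.
rewrite rcons_cat cat_path /= rcons_path last_map last_map.
case/and3P=> -> /eqP -> /andP[-> /eqP ->]; split=> //; split=> //.
apply/setP => p; rewrite CE inE -(fconnect_cycle cyc (mem_head _ _)).
apply/idP/porbitP => [/iter_findex <-|[i ->]].
  by exists (findex sigma (bg a) p); rewrite permX.
by rewrite permX fconnect_iter.
Qed.

(** The turning points of an exchange cycle are unique: the type of the
    letters changes only at its first and last elements. *)
Lemma exchange_cycle_first C a b c d : exchange_cycle sigma C a b ->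
  bg c \in C -> sigma (en d) = bg c -> c = a.
Proof.
move=> /exchange_cycle_parts[s [t [ps _ _ _ [_ ->]]]].
rewrite inE mem_cat => /orP[|/mapP[e _ //]].
rewrite (mem_map bg_inj) inE => /predU1P[//|cs] E.
exfalso; elim: s a ps cs => //= e s IH a /andP[/eqP Ea ps].
rewrite inE => /predU1P[ce|/(IH _ ps)//].
by move: E; rewrite ce -Ea => /perm_inj.
Qed.

Lemma exchange_cycle_last C a b c d : exchange_cycle sigma C a b ->
  bg c \in C -> sigma (bg c) = en d -> d = b.
Proof.
move=> /exchange_cycle_parts[s [t [ps E _ _ [_ ->]]]].
rewrite inE mem_cat => /orP[|/mapP[e _ //]].
rewrite (mem_map bg_inj) => cs Ec.
elim: s a ps cs E => [|e s IH] a /=.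
  by move=> _; rewrite inE => /eqP <-; rewrite Ec => -[].
move=> /andP[/eqP Ea ps]; rewrite inE => /predU1P[ca|cs] E; last exact: IH ps cs E.
by move: Ea; rewrite -ca Ec.
Qed.

End ExchangeCycles.

Section LevelCycles.
Context (R : realType) (A : finType) (sigma : {perm doubled A}).
Context (y : doubled A -> R).
Hypothesis y_up : forall a, y (bg a) < y (sigma (bg a)).
Hypothesis y_down : forall a, y (sigma (en a)) < y (en a).

Lemma sorted_ends_split (c : seq (doubled A)) :
  sorted (fun p q => p.2 ==> q.2) c ->
  exists s t, c = map (@bg A) s ++ map (@en A) t.
Proof.
elim: c => [|[a []] c IH] h; first by exists [::], [::].
  exists [::], (map fst ((a, true) :: c)) => /=; congr (_ :: _).
  move: h => /=; elim: c a {IH} => //= -[a' b'] c IH a /andP[/= -> ].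
  by move=> /IH <-.
have [s [t ->]] := IH (path_sorted h).
by exists (a :: s), t.
Qed.

(** Beginnings go up and endings go down, so an orbit read from its lowest
    point starts with a beginning and closes with an ending. It cannot climb
    again once it has begun to descend: having reached some level downwards it
    would have to cross it downwards a second time. *)
Lemma exchange_cycle_of_levels (C : {set doubled A}) :
  (forall a b u, en a \in C -> en b \in C -> y (sigma (en a)) <= u < y (en a) ->
     y (sigma (en b)) <= u < y (en b) -> a = b) ->
  C \in porbits sigma -> exists a b, exchange_cycle sigma C a b.
Proof.
move=> down_inj /imsetP[p _ CE].
have pC : p \in C by rewrite CE porbit_id.
case: (arg_minP y pC) => p1 p1C p1min.
have CE1 : C = porbit sigma p1.
  by rewrite CE; apply/eqP; rewrite eq_sym eq_porbit_mem -CE.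
have iterC i : iter i sigma p1 \in C by rewrite CE1 -permX mem_porbit.
set c := fingraph.orbit sigma p1; set n := fingraph.order sigma p1.
have nthc i : (i < n)%N -> nth p1 c i = iter i sigma p1 by move=> h; rewrite nth_traject.
have szc : size c = n by rewrite fingraph.size_orbit.
have n0 : (0 < n)%N by exact: fingraph.order_gt0.
have itern : iter n sigma p1 = p1 by apply: iter_order; exact: perm_inj.
have cE : c = p1 :: behead c.
  by rewrite /c /fingraph.orbit -/n -(prednK n0).
have iter_inj i j : (i < j)%N -> (j < n)%N -> iter i sigma p1 <> iter j sigma p1.
  move=> ij jn E; have := fingraph.orbit_uniq sigma p1 => /(uniqP p1)/(_ i j).
  rewrite !inE fingraph.size_orbit -/n jn (ltn_trans ij jn) !nthc ?(ltn_trans ij jn)//.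
  by move=> /(_ isT isT E) ije; rewrite ije ltnn in ij.
have srt : sorted (fun p q : doubled A => p.2 ==> q.2) c.
  apply/(sortedP p1) => i; rewrite szc => iN.
  rewrite !nthc ?(ltnW iN)//; apply/implyP.
  case Ei : (iter i sigma p1) => [e [] //] _.
  case Ei1 : (iter i.+1 sigma p1) => [b1 [] //]; exfalso.
  (* After climbing again at step [i.+1], the orbit stays above that level. *)
  have cross m : (i.+2 + m <= n)%N -> y (bg b1) < y (iter (i.+2 + m) sigma p1).
    elim: m => [|m IH] h; first by rewrite addn0 iterS Ei1 y_up.
    rewrite addnS in h *; have {}IH := IH (ltnW h).
    rewrite ltNge; apply/negP => le; rewrite iterS in le.
    case Ej : (iter (i.+2 + m) sigma p1) IH le => [e' b'] IH le.
    have b't : b' = true.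
      case: b' Ej IH le => // Ej IH le.
      by have := lt_le_trans (lt_trans IH (y_up e')) le; rewrite ltxx.
    rewrite {}b't in Ej IH le.
    apply: (@iter_inj i (i.+2 + m)%N) => //; first by rewrite addSn ltnS ltnW// leq_addr.
    rewrite Ei Ej -/(en e) -/(en e'); congr (en _).
    have Ce1 : en e \in C by rewrite /en -Ei iterC.
    have Ce2 : en e' \in C by rewrite /en -Ej iterC.
    have E1 : sigma (en e) = bg b1 by rewrite /en -Ei -iterS Ei1.
    apply: (down_inj _ _ (y (bg b1))) => //; last by rewrite le IH.
    by rewrite -E1 lexx /= y_down.
  have := cross (n - i.+2)%N; rewrite subnKC// leqnn itern => /(_ isT).
  have b1C : bg b1 \in C by have := iterC i.+1; rewrite Ei1.
  by rewrite ltNge p1min.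
have [s [t cst]] := sorted_ends_split srt.
have p1b : p1.2 = false.
  case E : p1 => [a []] //=; have := p1min _ (iterC 1%N); rewrite /= E.
  by rewrite leNgt y_down.
case: s cst => [|a s] cst.
  by move: cE p1b; rewrite cst; case: t {cst} => // b t /= [<-].
have p1a : p1 = bg a by move: cE; rewrite cst /= => -[].
case: t cst => [|b t] cst; last first.
  exists a, b, s, t; split.
    by rewrite -cst /ucycle cycle_orbit ?fingraph.orbit_uniq//; exact: perm_inj.
  apply/setP => q; rewrite -cst inE -fconnect_orbit CE1.
  apply/porbitP/idP => [[i ->]|/iter_findex <-]; first by rewrite permX fconnect_iter.
  by exists (findex sigma p1 q); rewrite permX.
have /= := cycle_orbit (@perm_inj _ sigma) p1.
rewrite -/c cst cats0 /= rcons_path => /andP[_ /eqP]; rewrite last_map => E.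
have h : bg (last a s) \in c by rewrite cst cats0; exact: (map_f (@bg A) (mem_last a s)).
have := y_up (last a s); rewrite E -p1a ltNge p1min//.
by move: h; rewrite -fconnect_orbit => /iter_findex <-; exact: iterC.
Qed.

End LevelCycles.

(** * The cohomology plane of a rotational scheme *)

(** The rows of [U] lie in the left kernel of [Q], and [U] and [Q] have at most
    one relation between their rows and between their columns respectively.
    By rank-nullity the rows of [U] then span this kernel. *)
Lemma span_of_corank1 (F : fieldType) (I J K : finType) (U : I -> J -> F)
    (Q : J -> K -> F) (u0 : I -> F) (q0 : K -> F) (x : J -> F) :
  (forall i k, \sum_j U i j * Q j k = 0) ->
  (forall c, (forall j, \sum_i c i * U i j = 0) ->
     exists t, forall i, c i = t * u0 i) ->
  (forall c, (forall j, \sum_k Q j k * c k = 0) ->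
     exists t, forall k, c k = t * q0 k) ->
  (#|J| + 2 <= #|I| + #|K|)%N ->
  (forall k, \sum_j x j * Q j k = 0) ->
  exists c, forall j, x j = \sum_i c i * U i j.
Proof.
move=> UQ kU kQ card_le xQ.
pose MU := \matrix_(i < #|I|, j < #|J|) U (enum_val i) (enum_val j).
pose MQ := \matrix_(j < #|J|, k < #|K|) Q (enum_val j) (enum_val k).
pose X := \row_(j < #|J|) x (enum_val j).
have rk1 (n m : nat) (M : 'M[F]_(n, m)) (v0 : 'rV_n) :
    (forall v : 'rV_n, v *m M = 0 -> exists t, v = t *: v0) -> (n <= \rank M + 1)%N.
  move=> h; suff : (\rank (kermx M) <= 1)%N.
    by rewrite mxrank_ker leq_subLR addnC.
  apply: leq_trans (rank_leq_row v0); apply: mxrankS.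
  by apply/rV_subP => v /sub_kermxP /h[t ->]; exact: scalemx_sub.
have sumE (L : finType) (f : L -> F) : \sum_(i < #|L|) f (enum_val i) = \sum_i f i.
  by rewrite [RHS](reindex _ (onW_bij _ (enum_val_bij L))).
have rU : (#|I| <= \rank MU + 1)%N.
  apply: (rk1 _ _ _ (\row_i u0 (enum_val i))) => v vM.
  have [j|t tP] := kU (fun i => v 0 (enum_rank i)).
    have := congr1 (fun w : 'rV_#|J| => w 0 (enum_rank j)) vM.
    rewrite !mxE => E; rewrite -sumE -[RHS]E; apply: eq_bigr => i _.
    by rewrite mxE !enum_valK enum_rankK.
  by exists t; apply/rowP => i; rewrite !mxE -tP enum_valK.
have rQ : (#|K| <= \rank MQ + 1)%N.
  rewrite -mxrank_tr.
  apply: (rk1 _ _ _ (\row_i q0 (enum_val i))) => v vM.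
  have [j|t tP] := kQ (fun i => v 0 (enum_rank i)).
    have := congr1 (fun w : 'rV_#|J| => w 0 (enum_rank j)) vM.
    rewrite !mxE => E; rewrite -sumE -[RHS]E; apply: eq_bigr => i _.
    by rewrite !mxE !enum_valK enum_rankK mulrC.
  by exists t; apply/rowP => i; rewrite !mxE -tP enum_valK.
have UQ0 : (MU <= kermx MQ)%MS.
  apply/sub_kermxP/matrixP => i k; rewrite !mxE.
  under eq_bigr do rewrite !mxE.
  by rewrite (sumE _ (fun j => U (enum_val i) j * Q j (enum_val k))) UQ.
have XQ0 : (X <= kermx MQ)%MS.
  apply/sub_kermxP/matrixP => i k; rewrite !mxE.
  under eq_bigr do rewrite !mxE.
  by rewrite (sumE _ (fun j => x j * Q j (enum_val k))) xQ.
have /submxP[D XD] : (X <= MU)%MS.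
  apply: submx_trans XQ0 _; rewrite -(mxrank_leqif_sup UQ0).
  rewrite eqn_leq mxrankS//= mxrank_ker leq_subLR.
  have : (#|J| + 2 <= \rank MU + 1 + (\rank MQ + 1))%N.
    exact: leq_trans card_le (leq_add rU rQ).
  by rewrite addnACA leq_add2r addnC.
exists (fun i => D 0 (enum_rank i)) => j.
have := congr1 (fun w : 'rV_#|J| => w 0 (enum_rank j)) XD.
rewrite !mxE enum_rankK => ->; rewrite -(sumE _ (fun i => _ * U i j)).
apply: eq_bigr => i _; by rewrite mxE !enum_valK enum_rankK.
Qed.

Section Span.
Context (R : realType) (A : finType) (sigma : {perm doubled A}).

Definition has_exchange_cycles (s : {perm doubled A}) : Prop :=
  forall C, C \in porbits s -> exists a b, exchange_cycle s C a b.

Lemma exchange_first_inj (s : {perm doubled A}) a b c d :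
  has_exchange_cycles s -> s (en c) = bg a -> s (en d) = bg b ->
  bg b \in porbit s (bg a) -> b = a.
Proof.
move=> hc sc sd ba.
have [|a1 [b1 cyc]] := hc (porbit s (bg a)); first exact: imset_f.
rewrite (exchange_cycle_first cyc ba sd).
by rewrite (exchange_cycle_first cyc (porbit_id _ _) sc).
Qed.

(** Every cycle of either permutation turns exactly once from endings to
    beginnings, and the predecessor of [bg a] is an ending for exactly one of
    the two permutations. Hence there are as many vertices as letters, Euler's
    formula gives a torus, and its first cohomology is a plane, spanned by two
    classes with nonzero cup product. *)
Lemma cochain_span (x y z : doubled A -> R) :
  irreducible_scheme sigma -> has_exchange_cycles sigma ->
  has_exchange_cycles (dual sigma) ->
  closed_cochain sigma x -> closed_cochain sigma y -> closed_cochain sigma z ->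
  pairing sigma y z != 0 ->
  exists s t f g, [/\ invariant_under sigma f, invariant_under (dual sigma) g
    & forall p, x p = s * y p + t * z p + f p + g p].
Proof.
move=> irr hs hd xc yc zc yz0.
pose ft a := (sigma^-1%g (bg a)).2.
have ftT a : ft a -> exists c, sigma (en c) = bg a.
  rewrite /ft; case E : (sigma^-1%g (bg a)) => [c []] // _.
  by exists c; rewrite /en -E permKV.
have ftF a : ~~ ft a -> exists c, dual sigma (en c) = bg a.
  rewrite /ft; case E : (sigma^-1%g (bg a)) => [c []] // _.
  by exists c; rewrite dual_en /bg -E permKV.
(* The vertex indexed by [a] is the cycle that turns at [bg a]. *)
pose V a p : R := if ft a then (p \in porbit sigma (bg a))%:R
                  else (p \in porbit (dual sigma) (bg a))%:R.
pose U (i : A + bool) p : R :=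
  match i with inl a => V a p | inr true => y p | inr false => z p end.
pose F (c : A -> R) p := \sum_(a | ft a) c a * V a p.
pose G (c : A -> R) p := \sum_(a | ~~ ft a) c a * V a p.
have Fs c : invariant_under sigma (F c).
  move=> p; apply: eq_bigr => a fa; rewrite /V fa; congr (_ * _%:R).
  by rewrite -!eq_porbit_mem porbit_step.
have Gs c : invariant_under (dual sigma) (G c).
  move=> p; apply: eq_bigr => a /negbTE fa; rewrite /V fa; congr (_ * _%:R).
  by rewrite -!eq_porbit_mem porbit_step.
have sumU c p : \sum_i c i * U i p =
    F (c \o inl) p + G (c \o inl) p + (c (inr true) * y p + c (inr false) * z p).
  by rewrite big_sumType big_bool /= /F /G [X in X + _](bigID ft).
pose Q p a : R := (p == sigma (bg a))%:R + (p == sigma (en a))%:R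
                  - (p == bg a)%:R - (p == en a)%:R.
have sumdelta (w : doubled A -> R) q : \sum_p w p * (p == q)%:R = w q.
  rewrite (bigD1 q)//= eqxx mulr1 big1 ?addr0// => p /negbTE ->.
  by rewrite mulr0.
have sumQ (w : doubled A -> R) a : \sum_p w p * Q p a =
    w (sigma (bg a)) + w (sigma (en a)) - w (bg a) - w (en a).
  rewrite -(sumdelta w (sigma (bg a))) -(sumdelta w (sigma (en a))).
  rewrite -(sumdelta w (bg a)) -(sumdelta w (en a)) -!sumrN -!big_split /=.
  apply: eq_bigr => p _.
  by rewrite /Q; ring.
have Vc a : closed_cochain sigma (V a).
  rewrite /V; case: (ft a).
    apply: invariant_closed => p /=.
    by rewrite -!eq_porbit_mem porbit_step.
  apply: dual_invariant_closed => p /=.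
  by rewrite -!eq_porbit_mem porbit_step.
have wQ0 (w : doubled A -> R) a : closed_cochain sigma w -> \sum_p w p * Q p a = 0.
  by move=> wc; rewrite sumQ wc; ring.
pose u0 (i : A + bool) : R :=
  match i with inl a => if ft a then 1 else -1 | inr _ => 0 end.
case: (@span_of_corank1 R (A + bool)%type (doubled A) A U Q u0 (fun=> 1) x).
- by case=> [a|[]] k; apply: wQ0 => //; exact: Vc.
- (* A relation between the rows only involves vertices, and the only
     relation between vertices says that each edge has one end of each kind. *)
  move=> c c0; pose d := c \o inl; pose s := c (inr true); pose t := c (inr false).
  have E p : F d p + G d p + (s * y p + t * z p) = 0 by rewrite -sumU.
  have Fc := invariant_closed (Fs d); have Gc := dual_invariant_closed (Gs d).
  have pE w : closed_cochain sigma w ->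
      s * pairing sigma y w + t * pairing sigma z w = 0.
    move=> wc.
    have : pairing sigma
        ((F d \+ G d) \+ ((fun p => s * y p) \+ (fun p => t * z p))) w = 0.
      rewrite (@pairing_ext _ _ _ _ (fun=> 0) _ w _ (fun=> erefl)); last by move=> p; exact: E.
      by apply: pairing_invl.
    by rewrite !pairingDl !pairingZl pairing_invl// pairing_dual_invl// !add0r.
  have t0 : t = 0.
    have := pE y yc; rewrite (pairing_antisym zc yc) pairing_self//.
    rewrite mulr0 add0r mulrN => /eqP; rewrite oppr_eq0 mulf_eq0 (negbTE yz0) orbF.
    by move/eqP.
  have s0 : s = 0.
    have := pE z zc; rewrite t0 mul0r addr0 => /eqP.
    by rewrite mulf_eq0 (negbTE yz0) orbF => /eqP.
  have FG p : F d p = - G d p.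
    by apply/eqP; rewrite -addr_eq0; have := E p; rewrite s0 t0 !mul0r !addr0 => ->.
  have Fdual : invariant_under (dual sigma) (F d) by move=> p; rewrite !FG Gs.
  have Fconst := irreducible_invariant irr (Fs d) Fdual.
  have Fd a : ft a -> F d (bg a) = d a.
    move=> fa; rewrite /F (bigD1 a)//= {1}/V fa porbit_id mulr1 big1 ?addr0//.
    move=> b /andP[fb ba]; rewrite /V fb.
    case: (boolP (bg a \in _)) => [h|_]; last by rewrite mulr0.
    have [[cb cbE] [ca caE]] := (ftT _ fb, ftT _ fa).
    by rewrite (exchange_first_inj hs cbE caE h) eqxx in ba.
  have Gd a : ~~ ft a -> G d (bg a) = d a.
    move=> fa; rewrite /G (bigD1 a)//= {1}/V (negbTE fa) porbit_id mulr1 big1 ?addr0//.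
    move=> b /andP[fb ba]; rewrite /V (negbTE fb).
    case: (boolP (bg a \in _)) => [h|_]; last by rewrite mulr0.
    have [[cb cbE] [ca caE]] := (ftF _ fb, ftF _ fa).
    by rewrite (exchange_first_inj hd cbE caE h) eqxx in ba.
  case: (pickP (fun _ : A => true)) => [a0 _|noA]; last first.
    by exists 0; case=> [a|[]]; [have := noA a|rewrite mul0r|rewrite mul0r].
  exists (F d (bg a0)); case=> [a|[]]; last 2 first.
  + by rewrite mulr0 -[LHS]/s s0.
  + by rewrite mulr0 -[LHS]/t t0.
  rewrite (Fconst (bg a0) (bg a)) /= -[LHS]/(d a); case: ifP => fa; first by rewrite mulr1 Fd.
  by rewrite FG Gd ?fa// mulrN1 opprK.
- move=> c cQ.
  have cE q : c (sigma q).1 = c q.1.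
    have : \sum_r ((sigma q == sigma r)%:R - (sigma q == r)%:R) * c r.1 = 0.
      rewrite -[RHS](cQ (sigma q)) big_doubled; apply: eq_bigr => a _.
      by rewrite /Q /=; ring.
    rewrite (eq_bigr (fun r => c r.1 * (r == q)%:R - c r.1 * (r == sigma q)%:R)).
      by rewrite sumrB !sumdelta => /eqP; rewrite subr_eq0 => /eqP.
    by move=> r _; rewrite (inj_eq perm_inj) ![_ == r]eq_sym; ring.
  case: (pickP (fun _ : A => true)) => [a0 _|noA]; last first.
    by exists 0 => a; have := noA a.
  exists (c a0) => a; rewrite mulr1.
  apply: (irreducible_invariant (f := fun p => c p.1) irr _ _ (bg a) (bg a0)) => //.
  by move=> p; rewrite /= permM permE cE.
- by rewrite card_prod card_sum card_bool muln2 -addnn addnAC.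
- by move=> k; exact: wQ0.
move=> c xE; exists (c (inr true)), (c (inr false)), (F (c \o inl)), (G (c \o inl)).
by split=> // p; rewrite xE sumU; ring.
Qed.

End Span.

(** * Positive integral heights *)

Lemma eventually_dominates (R : realType) (I : finType) (d e : I -> R) :
  exists c : nat, forall n i, (c <= n)%N -> d i != 0 -> `|e i| < n%:R * `|d i|.
Proof.
pose S := \sum_i `|e i| / `|d i|.
have t0 i : 0 <= `|e i| / `|d i| by rewrite mulr_ge0 ?invr_ge0.
exists (Num.trunc S).+1 => n i cn di.
have d0 : 0 < `|d i| by rewrite normr_gt0.
rewrite -ltr_pdivrMr//; apply: (@le_lt_trans _ _ S).
  by rewrite /S (bigD1 i)//= lerDl sumr_ge0.
apply: lt_le_trans (truncnS_gt S) _.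
by rewrite ler_nat.
Qed.

(** Pigeonhole on the boxes of side [1 / Q.+1] containing the fractional parts
    of the multiples of [y]. *)
Lemma simultaneous_dirichlet (R : realType) (J : finType) (y : J -> R) (Q : nat) :
  exists2 N : nat, (0 < N)%N &
    exists Y : J -> int, forall j, `|N%:R * y j - (Y j)%:~R| * Q.+1%:R < 1.
Proof.
pose fr t : R := t - (Num.floor t)%:~R.
have fr0 t : 0 <= fr t by rewrite subr_ge0 floor_le.
have fr1 t : fr t < 1.
  by rewrite ltrBlDr addrC; have := floorD1_gt t; rewrite intrD.
pose bx t : nat := Num.trunc (fr t * Q.+1%:R).
have bxi t : (bx t)%:R <= fr t * Q.+1%:R < (bx t).+1%:R.
  by apply: truncn_itv; rewrite mulr_ge0.
have bxQ t : (bx t < Q.+1)%N.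
  have /andP[h _] := bxi t; rewrite -(ltr_nat R); apply: le_lt_trans h _.
  by rewrite gtr_pMl ?ltr0n.
pose n := #|{ffun J -> 'I_Q.+1}|.
pose F (k : 'I_n.+1) := [ffun j => Ordinal (bxQ (k%:R * y j))] : {ffun J -> 'I_Q.+1}.
have : ~~ injectiveb F.
  by apply/injectiveP => /leq_card; rewrite card_ord -/n ltnn.
case/injectivePn => k [k' kk' FE].
wlog lt_kk' : k k' kk' FE / (k < k')%N.
  move=> W; case: (ltngtP k k') => [| |/ord_inj kE]; [exact: W| |by rewrite kE eqxx in kk'].
  by apply: W => //; rewrite eq_sym.
exists (k' - k)%N; first by rewrite subn_gt0.
exists (fun j => Num.floor (k'%:R * y j) - Num.floor (k%:R * y j)) => j.
have := congr1 (fun G : {ffun J -> 'I_Q.+1} => nat_of_ord (G j)) FE.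
rewrite !ffunE /= => bE.
have /andP[] := bxi (k'%:R * y j); have /andP[] := bxi (k%:R * y j).
rewrite bE natrB 1?ltnW// intrB.
have -> : (k'%:R - k%:R) * y j - ((Num.floor (k'%:R * y j))%:~R -
   (Num.floor (k%:R * y j))%:~R) = fr (k'%:R * y j) - fr (k%:R * y j).
  by rewrite /fr; ring.
set b := bx _; set u := fr _; set v := fr _ => h1 h2 h3 h4.
rewrite -[X in _ * X]ger0_norm// -normrM mulrBl ltr_norml.
rewrite -natr1 in h2 h4; apply/andP; split; lra.
Qed.

Section Heights.
Context (R : realType) (A : finType) (sigma : {perm doubled A}).

Lemma closed_intr (y : doubled A -> int) :
  closed_cochain sigma y -> closed_cochain sigma (fun p => (y p)%:~R : R).
Proof. by move=> yc a; rewrite -!intrD yc. Qed.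

Lemma height_intr (y : doubled A -> int) a :
  height sigma (fun p => (y p)%:~R : R) a = (height sigma y a)%:~R.
Proof. by rewrite /height intrB. Qed.

Lemma pairing_intr (y z : doubled A -> int) :
  pairing sigma (fun p => (y p)%:~R : R) (fun p => (z p)%:~R) =
  (pairing sigma y z)%:~R.
Proof.
rewrite /pairing (big_morph (fun n : int => n%:~R : R) (@intrD R) (erefl _)).
apply: eq_bigr => a _.
by rewrite intrM /width intrB height_intr.
Qed.

(** Round a large multiple of [w] that is almost integral. The closing
    condition survives the rounding because it is an equation between
    integers that holds up to an error less than 1. *)
Lemma integer_cochain (w : doubled A -> R) (P : rel (doubled A)) :
  closed_cochain sigma w -> (forall a, 0 < height sigma w a) ->
  (forall p q, P p q -> w p != w q) ->
  exists y : doubled A -> int, [/\ closed_cochain sigma y,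
    forall a, 0 < height sigma y a & forall p q, P p q -> y p != y q].
Proof.
move=> wc wh wP.
have [c1 c1P] := eventually_dominates (height sigma w) (fun=> 1).
have [c2 c2P] := eventually_dominates (fun pq => w pq.1 - w pq.2) (fun=> 1).
pose c := maxn c1 c2.
(* Errors below 1/5 keep the four-term sums below 1; the factor [c] makes all
   heights and gaps at least 1. *)
have [N N0 [Y YP]] := simultaneous_dirichlet (fun p => c%:R * w p) 4.
pose e p : R := N%:R * (c%:R * w p) - (Y p)%:~R.
have e5 p : - 1 < e p * 5 < 1.
  have := YP p; rewrite -/(e p) -[X in _ * X]ger0_norm// -normrM.
  by rewrite ltr_norml.
have YE p : (Y p)%:~R = N%:R * (c%:R * w p) - e p by rewrite /e; ring.
have N1 : 1 <= N%:R :> R by rewrite ler1n.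
exists Y; split=> [a|a|p q Ppq].
- set p1 := sigma (bg a); set p2 := sigma (en a); set p3 := bg a; set p4 := en a.
  set D := Y p1 + Y p2 - (Y p3 + Y p4).
  have DE : D%:~R = e p3 + e p4 - e p1 - e p2.
    rewrite /D intrB !intrD !YE.
    have -> : w p1 = w p3 + w p4 - w p2 by rewrite -wc addrK.
    ring.
  have := e5 p1; have := e5 p2; have := e5 p3; have := e5 p4.
  move=> /andP[? ?] /andP[? ?] /andP[? ?] /andP[? ?].
  have l : (-1 < D)%R by rewrite -(ltr_int R) DE intrN; lra.
  have u : (D < 1)%R by rewrite -(ltr_int R) DE; lra.
  have : D = 0 by move: l u; case: (D) => [[|?]|?].
  by move/eqP; rewrite subr_eq0 => /eqP.
- rewrite -(ltr_int R) -height_intr /height !YE.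
  have : 1 <= N%:R * (c%:R * height sigma w a).
    rewrite -[leLHS]mul1r ler_pM//.
    have := c1P c a (leq_maxl _ _) (lt0r_neq0 (wh a)).
    by rewrite normr1 gtr0_norm// => /ltW.
  have := e5 (sigma (en a)); have := e5 (bg a).
  move=> /andP[? ?] /andP[? ?]; rewrite /height mulrBr mulrBr; lra.
- rewrite -(inj_eq (@intr_inj R)) !YE -subr_eq0.
  have d0 : w p - w q != 0 by rewrite subr_eq0 wP.
  have := c2P c (p, q) (leq_maxr _ _) d0; rewrite /= normr1 => h.
  have : 1 < N%:R * (c%:R * `|w p - w q|).
    by apply: lt_le_trans h _; rewrite ler_peMl// mulr_ge0.
  apply: contraTneq => E.
  have -> : N%:R * (c%:R * `|w p - w q|) = `|e p - e q|.
    rewrite -[N%:R]ger0_norm// -[c%:R]ger0_norm// -!normrM; congr (`|_|).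
    by apply/eqP; rewrite -subr_eq0 -[X in _ == X]E; apply/eqP; ring.
  rewrite -leNgt ler_norml; have := e5 p; have := e5 q.
  by move=> /andP[? ?] /andP[? ?]; apply/andP; split; lra.
Qed.

(** [p] is the left end of a segment and [q] the right end of one: these are
    the elements whose type differs from that of their predecessor. *)
Definition facing_ends : rel (doubled A) := fun p q =>
  [&& ~~ p.2, (sigma^-1%g p).2, q.2 & ~~ (sigma^-1%g q).2].

(** Move the segments far apart on the line; in a single segment the left end
    differs from the right end anyway. *)
Lemma spread_cochain (x : doubled A -> R) :
  has_exchange_cycles sigma -> closed_cochain sigma x ->
  (forall a, 0 < width sigma x a) ->
  exists2 w : doubled A -> R, closed_cochain sigma w & forall p q, facing_ends p q -> w p != w q.
Proof.
move=> hs xc xw.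
have [B BP] := eventually_dominates (fun=> 1) (fun pq => x pq.1 - x pq.2).
pose h p : R := B%:R * (enum_rank (porbit sigma p))%:R.
exists (x \+ h).
  apply: closedD => //; apply: invariant_closed => p; rewrite /h.
  by rewrite porbit_step.
case=> [a []] // [b []]; rewrite /facing_ends /= ?andbF // => /andP[fa].
  case E : (sigma^-1%g _) fa => [d []] // _; case E' : (sigma^-1%g _) => [e []] // _.
have Ea : sigma (en d) = bg a by rewrite /en -E permKV.
have Eb : sigma (bg e) = en b by rewrite /bg -E' permKV.
rewrite -/(bg a) -/(en b) /= -subr_eq0 opprD addrACA.
have [same|diff] := eqVneq (porbit sigma (bg a)) (porbit sigma (en b)).
  rewrite /h same subrr addr0 subr_eq0 lt_eqF//.
  have [|a1 [b1 cyc]] := hs (porbit sigma (bg a)); first exact: imset_f.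
  have aa1 := exchange_cycle_first cyc (porbit_id _ _) Ea.
  have bb1 : b = b1.
    apply: (exchange_cycle_last cyc _ Eb); rewrite same -Eb.
    by rewrite -eq_porbit_mem porbit_step.
  have [s [t [ps sE _ _ _]]] := exchange_cycle_parts cyc.
  have up : {in map (@bg A) (a1 :: s), forall r, x r < x (sigma r)}.
    by move=> r /mapP[c _ ->]; rewrite -subr_gt0; exact: xw.
  have [_] := rising_path_ge ps up (mem_head _ _).
  rewrite last_map sE bb1 aa1; apply: lt_le_trans.
  by apply: up; rewrite mem_head.
have := BP B (bg a, en b) (leqnn _) (oner_neq0 _); rewrite normr1 mulr1 /=.
rewrite /h -mulrBr; set i := enum_rank _; set j := enum_rank _.
have ij : (i : nat) != j.
  by apply: contra diff => /eqP /ord_inj /enum_rank_inj ->.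
rewrite addr_eq0; apply: contraTneq => ->; rewrite normrN normrM normr_nat.
rewrite -leNgt ler_peMr//.
have [lt|lt|E0] := ltngtP i j; last by rewrite E0 eqxx in ij.
  by rewrite distrC -natrB 1?ltnW// normr_nat ler1n subn_gt0.
by rewrite -natrB 1?ltnW// normr_nat ler1n subn_gt0.
Qed.

(** The integral basis of the cohomology plane. Perturbing a positive cochain
    by a spread one separates facing ends, and rounding gives an integral
    cochain [Y]; its class is [g] times a class [h'], and [u] has cup product 1
    with [h']. Then [h := m * Y + u] is again positive for large [m], while
    [h'] and [h] have cup product 1. The last clause gives the coordinates of a
    cocycle in this basis. *)
Lemma closed_heights (x y : doubled A -> R) :
  (0 < #|A|)%N -> irreducible_scheme sigma -> has_exchange_cycles sigma ->
  has_exchange_cycles (dual sigma) ->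
  closed_cochain sigma x -> (forall a, 0 < width sigma x a) ->
  closed_cochain sigma y -> (forall a, 0 < height sigma y a) ->
  exists h h' : doubled A -> int,
    [/\ closed_cochain sigma h, forall a, 0 < height sigma h a,
        forall p q, facing_ends p q -> h p != h q, pairing sigma h' h = 1
      & forall z : doubled A -> R, closed_cochain sigma z ->
        exists M f g, [/\ invariant_under sigma f, invariant_under (dual sigma) g
        & forall p, z p = pairing sigma z (fun p => (h p)%:~R) * (h' p)%:~R
             + M * (h p)%:~R + f p + g p]].
Proof.
move=> A0 irr hs hd xc xw yc yh.
have [w0 w0c w0P] := spread_cochain hs xc xw.
have [n1 n1P] := eventually_dominates (height sigma y) (height sigma w0).
have [n2 n2P] := eventually_dominates (fun pq => y pq.1 - y pq.2)
                                      (fun pq => w0 pq.1 - w0 pq.2).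
pose n := maxn n1 n2.
have [||p q Ppq|Y [Yc Yh YP]] :=
    @integer_cochain (fun p => n%:R * y p + w0 p) facing_ends.
- exact: (closedD (closedZ _ yc) w0c).
- move=> a; have := n1P n a (leq_maxl _ _) (lt0r_neq0 (yh a)).
  rewrite (gtr0_norm (yh a)) ltr_norml => /andP[h1 _]; rewrite /height.
  have -> : n%:R * y (sigma (en a)) + w0 (sigma (en a)) -
     (n%:R * y (bg a) + w0 (bg a)) = n%:R * height sigma y a + height sigma w0 a.
    by rewrite /height; ring.
  lra.
- rewrite -subr_eq0.
  have -> : n%:R * y p + w0 p - (n%:R * y q + w0 q) =
    n%:R * (y p - y q) + (w0 p - w0 q) by ring.
  have [-> |d0] := eqVneq (y p - y q) 0.
    by rewrite mulr0 add0r subr_eq0 w0P.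
  have := n2P n (p, q) (leq_maxr _ _) d0 => /=.
  apply: contraTneq => /eqP; rewrite addrC addr_eq0 => /eqP ->.
  by rewrite normrN normrM normr_nat ltxx.
have [g [u [f [k [h' [uc Yu fs kd YE]]]]]] := integer_periods irr Yc.
have pairYY := pairing_self Yc.
have fc := invariant_closed fs; have kc := dual_invariant_closed kd.
(* Otherwise [Y] is a coboundary, while its area against [x] is positive. *)
have g0 : g != 0.
  apply/eqP => g0.
  have : 0 < pairing sigma x (fun p => (Y p)%:~R).
    case: (pickP (fun _ : A => true)) => [a0 _|noA]; last first.
      by move: A0; rewrite eq_card0.
    rewrite /pairing (bigD1 a0)//= ltr_wpDr ?sumr_ge0//.
      by move=> a _; rewrite mulr_ge0 ?ltW ?height_intr ?ltr0z.
    by rewrite mulr_gt0 ?height_intr ?ltr0z.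
  rewrite (@pairing_ext _ _ _ x x _
    ((fun p => (f p)%:~R) \+ (fun p => (k p)%:~R)) (fun=> erefl)).
    rewrite pairingDr pairing_invr// ?pairing_dual_invr ?addr0 ?ltxx//.
      by move=> p; rewrite kd.
    by move=> p; rewrite fs.
  by move=> p; rewrite YE g0 mul0r add0r intrD.
have gh'E : (fun p => g * h' p) =1 (Y \- f) \- k.
  by move=> p /=; rewrite YE; ring.
have h'c : closed_cochain sigma h'.
  have gc := closed_ext (fun p => esym (gh'E p)) (closedB (closedB Yc fc) kc).
  by move=> a; apply: (mulfI g0); have := gc a; rewrite -!mulrDr.
have pair_h' z : closed_cochain sigma z ->
    g * pairing sigma h' z = pairing sigma Y z.
  move=> zc; rewrite -pairingZl.
  have YE' : Y =1 (fun p => g * h' p) \+ (f \+ k) by move=> p /=; rewrite YE addrA.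
  rewrite (pairing_ext sigma YE' (fun=> erefl)).
  by rewrite !pairingDl (pairing_invl _ fs) (pairing_dual_invl zc kd) !addr0.
have h'Y : pairing sigma h' Y = 0.
  by apply: (mulfI g0); rewrite pair_h'// pairYY mulr0.
have h'u : pairing sigma h' u = 1.
  by apply: (mulfI g0); rewrite pair_h'// Yu mulr1.
have [m1 m1P] := eventually_dominates (fun a => (height sigma Y a)%:~R : R)
                                      (fun a => (height sigma u a)%:~R).
have [m2 m2P] := eventually_dominates (fun pq => (Y pq.1 - Y pq.2)%:~R : R)
                                      (fun pq => (u pq.1 - u pq.2)%:~R).
pose m := maxn m1 m2.
pose h p := (m : int) * Y p + u p.
have hc : closed_cochain sigma h by exact: (closedD (closedZ _ Yc) uc).
have h'h : pairing sigma h' h = 1.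
  by rewrite [LHS](pairingDr sigma h' (fun p => (m : int) * Y p) u)
             pairingZr h'Y mulr0 add0r h'u.
have mE : m%:R = (m : int)%:~R :> R by rewrite pmulrn.
exists h, h'; split=> // [a|p q Ppq|z zc].
- have Ya0 : (height sigma Y a)%:~R != 0 :> R by rewrite intr_eq0 lt0r_neq0.
  have := m1P m a (leq_maxl _ _) Ya0.
  rewrite [X in _ * X]gtr0_norm ?ltr0z// ltr_norml => /andP[h1 _].
  rewrite -(ltr_int R); have -> : height sigma h a =
     (m : int) * height sigma Y a + height sigma u a by rewrite /height /h; ring.
  rewrite intrD intrM -mE; lra.
- have d0 : (Y p - Y q)%:~R != 0 :> R by rewrite intr_eq0 subr_eq0 YP.
  have := m2P m (p, q) (leq_maxr _ _) d0 => /=.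
  rewrite -subr_eq0; have -> : h p - h q = (m : int) * (Y p - Y q) + (u p - u q).
    by rewrite /h; ring.
  apply: contraTneq => /eqP; rewrite addrC addr_eq0 => /eqP ->.
  by rewrite intrN normrN intrM -mE normrM normr_nat ltxx.
pose hR p : R := (h p)%:~R; pose h'R p : R := (h' p)%:~R.
have hRc : closed_cochain sigma hR by exact: closed_intr.
have h'Rc : closed_cochain sigma h'R by exact: closed_intr.
have pR : pairing sigma h'R hR = 1 by rewrite pairing_intr h'h.
have [|s [t [f0 [g1 [f0s g1d zE]]]]] :=
    @cochain_span R A sigma z h'R hR irr hs hd zc h'Rc hRc.
  by rewrite pR oner_neq0.
have zE' : z =1 ((fun p => s * h'R p) \+ (fun p => t * hR p)) \+ (f0 \+ g1).
  by move=> p /=; rewrite zE !addrA.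
have hh := pairing_self hRc.
have zh : pairing sigma z hR = s.
  rewrite (pairing_ext sigma zE' (fun=> erefl)) !pairingDl !pairingZl pR hh.
  by rewrite (pairing_invl _ f0s) (pairing_dual_invl hRc g1d); ring.
by exists t, f0, g1; split=> // p; rewrite zE zh.
Qed.

End Heights.

(** * The tower over the circle *)

Section FloorCounting.
Context (R : realType).

Definition primitive (phi : int -> int) (j : int) : int :=
  match j with
  | Posz n => \sum_(i < n) phi i%:Z
  | Negz n => - \sum_(i < n.+1) phi (- i.+1%:Z)
  end.

Lemma primitiveS phi j : primitive phi (j + 1) = primitive phi j + phi j.
Proof.
case: j => [n|[|n]].
- by rewrite -PoszD addn1 /= big_ord_recr.
- by rewrite /= big_ord0 big_ord_recr big_ord0 /=; ring.
have -> : Negz n.+1 + 1 = Negz n by rewrite !NegzE -addn1 PoszD; ring.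
rewrite /= [in RHS]big_ord_recr /= NegzE; ring.
Qed.

Lemma sum_primitive phi j n :
  \sum_(k < n) phi (j + k%:Z) = primitive phi (j + n%:Z) - primitive phi j.
Proof.
elim: n => [|n IH]; first by rewrite big_ord0 addr0 subrr.
by rewrite big_ord_recr /= IH -addn1 PoszD addrA primitiveS; ring.
Qed.

(** For [a <= b], the number of integers [j] such that [s + j * L] lies between
    [a] and [b]: the multiplicity with which the arc covers the point [s]. *)
Definition arc_count (L a b s : R) : int :=
  Num.floor ((s - a) / L) - Num.floor ((s - b) / L).

Lemma arc_count_ge0 L a b s : 0 < L -> a <= b -> 0 <= arc_count L a b s.
Proof.
by move=> L0 ab; rewrite subr_ge0 le_floor// ler_pM2r ?invr_gt0// lerD2l lerN2.
Qed.

Lemma arc_count_gt L a b s (j j' : int) : 0 < L -> j <= j' ->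
  a <= s + j%:~R * L -> s + j'%:~R * L < b -> j' - j < arc_count L a b s.
Proof.
move=> L0 jj' aj jb.
have h1 : - j <= Num.floor ((s - a) / L).
  by rewrite floor_ge_int ler_pdivlMr// intrN; lra.
have h2 : Num.floor ((s - b) / L) < - j'.
  by rewrite floor_lt_int ltr_pdivrMr// intrN; lra.
rewrite /arc_count; apply: lt_le_trans (_ : - j - Num.floor ((s - b) / L) <= _).
  by rewrite addrC ltrD2l ltrNr.
by rewrite lerD2r.
Qed.

End FloorCounting.

Section Tower.
Context (R : realType) (A : finType) (sigma : {perm doubled A}).
Context (w : doubled A -> R) (h n : doubled A -> int) (L M : R).
Context (g : doubled A -> R).
Hypothesis L_gt0 : 0 < L.
Hypothesis w_up : forall a, w (bg a) < w (sigma (bg a)).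
Hypothesis h_closed : closed_cochain sigma h.
Hypothesis h_up : forall a, 0 < height sigma h a.
Hypothesis n_h : pairing sigma n h = 1.
Hypothesis g_dual : invariant_under (dual sigma) g.
Hypothesis wE : forall p, w p = L * (n p)%:~R + M * (h p)%:~R + g p.

(** Over the beginning interval of [a] stand [storeys a] translates of it, by
    the multiples of [M]. *)
Definition storeys a : nat := `|height sigma h a|%N.

Lemma storeysE a : (storeys a)%:Z = height sigma h a.
Proof. by rewrite /storeys gez0_abs// ltW. Qed.

Lemma storeys_gt0 a : (0 < storeys a)%N.
Proof. by rewrite -ltz_nat storeysE. Qed.

(** Modulo [L], a left or right side of the storey at level [k] over [a] lies at
    [M * (h p + k) + g p] with [p] equal to [bg a] or [sigma (bg a)]. So along
    each cycle of the dual the left sides, stacked upwards, occupy the same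
    points as the right sides, stacked downwards. Their contributions to the
    floors cancel, except for the integers [n], whose contributions add up to
    the cup product of [n] and [h]. *)
Lemma tower_count (t : R) :
  \sum_a \sum_(k < storeys a)
    arc_count L (w (bg a)) (w (sigma (bg a))) (t - k%:R * M) = 1.
Proof.
pose phi q j := Num.floor ((t - g q - j%:~R * M) / L).
pose T q := primitive (phi q) (h q).
have floorE q (k : nat) :
    Num.floor ((t - k%:R * M - w q) / L) = phi q (h q + k%:Z) - n q.
  rewrite /phi; have -> : (t - k%:R * M - w q) / L =
      (t - g q - (h q + k%:Z)%:~R * M) / L + (- n q)%:~R.
    rewrite wE intrD intrN -pmulrn; field; exact: lt0r_neq0.
  by rewrite floorDrz ?intr_int// intrKfloor.
have phi_dual q : phi (dual sigma q) = phi q by rewrite /phi g_dual.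
transitivity (\sum_a (T (dual sigma (bg a)) - T (bg a)
   + (T (dual sigma (en a)) - T (en a)) + width sigma n a * height sigma h a)).
  apply: eq_bigr => a _; rewrite /arc_count.
  rewrite (eq_bigr (fun k : 'I_(storeys a) => (phi (bg a) (h (bg a) + k%:Z)
     - phi (sigma (bg a)) (h (sigma (bg a)) + k%:Z)) + width sigma n a)); last first.
    by move=> k _; rewrite !floorE /width; ring.
  rewrite big_split sumrB /= !sum_primitive storeysE sumr_const card_ord.
  rewrite -[X in _ + X]mulr_natr -[X in _ * X]/((storeys a)%:R) natz storeysE.
  rewrite /T !dual_bg !dual_en -(dual_bg sigma a) phi_dual -(dual_en sigma a) phi_dual.
  rewrite dual_bg dual_en.
  have -> : h (bg a) + height sigma h a = h (sigma (en a)) by rewrite /height; ring.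
  have -> : h (sigma (bg a)) + height sigma h a = h (en a).
    by rewrite closed_heightE//; ring.
  ring.
rewrite big_split /= -/(pairing sigma n h) n_h.
rewrite -(big_doubled (fun p => T (dual sigma p) - T p)) sumrB sum_perm.
by rewrite subrr add0r.
Qed.

Definition in_storey (t : R) a (k : nat) (j : int) : bool :=
  (k < storeys a)%N && (w (bg a) <= t - k%:R * M + j%:~R * L < w (sigma (bg a))).

(** All multiplicities are nonnegative and their sum is 1. *)
Lemma tower_unique t a k j a' k' j' :
  in_storey t a k j -> in_storey t a' k' j' -> [/\ a = a', k = k' & j = j'].
Proof.
have cnt0 b i : 0 <= arc_count L (w (bg b)) (w (sigma (bg b))) (t - i%:R * M).
  by rewrite arc_count_ge0// ltW.
have cnt1 b i l : in_storey t b i l ->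
    0 < arc_count L (w (bg b)) (w (sigma (bg b))) (t - i%:R * M).
  move=> /andP[_ /andP[h1 h2]]; have := arc_count_gt L_gt0 (lexx l) h1 h2.
  by rewrite subrr.
have rest0 b : 0 <= \sum_(k < storeys b)
    arc_count L (w (bg b)) (w (sigma (bg b))) (t - k%:R * M).
  by apply: sumr_ge0.
have rest1 b i l : in_storey t b i l -> 1 <= \sum_(k < storeys b)
    arc_count L (w (bg b)) (w (sigma (bg b))) (t - k%:R * M).
  move=> H; have /andP[ib _] := H.
  rewrite (bigD1 (Ordinal ib))//= -[leLHS]addr0 lerD ?sumr_ge0//.
  by rewrite -gtz0_ge1; exact: cnt1 H.
have total := tower_count t => H H'.
have aa' : a = a'.
  apply/eqP; apply: contraT => aa'; exfalso; move: total.
  rewrite (bigD1 a)//= (bigD1 a') 1?eq_sym//= => E.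
  have : (1 + (1 + 0) : int) <= 1.
    rewrite -[leRHS]E; apply: lerD; first exact: rest1 H.
    by apply: lerD; [exact: rest1 H'|apply: sumr_ge0 => b _; exact: rest0].
  by [].
move: H'; rewrite -{a'}aa' => H'.
have Wa : \sum_(k < storeys a)
    arc_count L (w (bg a)) (w (sigma (bg a))) (t - k%:R * M) <= 1.
  by rewrite -[leRHS]total (bigD1 a)//= lerDl; apply: sumr_ge0 => b _; exact: rest0.
have kk' : k = k'.
  apply/eqP; apply: contraT => kk'; exfalso; move: Wa.
  have /andP[ka _] := H; have /andP[ka' _] := H'.
  rewrite (bigD1 (Ordinal ka))//= (bigD1 (Ordinal ka')) 1?eq_sym//= => E.
  have : (1 + (1 + 0) : int) <= 1.
    apply: le_trans E.
    apply: lerD; first by rewrite -gtz0_ge1; exact: cnt1 H.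
    by apply: lerD; [rewrite -gtz0_ge1; exact: cnt1 H'|apply: sumr_ge0 => i _; exact: cnt0].
  by [].
move: H'; rewrite -{k'}kk' => H'; split=> //.
have cle : arc_count L (w (bg a)) (w (sigma (bg a))) (t - k%:R * M) <= 1.
  have /andP[ka _] := H; apply: le_trans Wa.
  by rewrite (bigD1 (Ordinal ka))//= lerDl; apply: sumr_ge0 => i _; exact: cnt0.
have no_gap l l' : in_storey t a k l -> in_storey t a k l' -> l < l' -> False.
  move=> /andP[_ /andP[h1 _]] /andP[_ /andP[_ h2]] ll'.
  have := lt_le_trans (arc_count_gt L_gt0 (ltW ll') h1 h2) cle.
  by move: ll'; rewrite -subr_gt0; case: (l' - l) => [[|?]|?].
by case: (ltgtP j j') => // [/(no_gap _ _ H H')|/(no_gap _ _ H' H)].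
Qed.

End Tower.

(** * Circles and segments *)

Local Open Scope classical_set_scope.

Section CircleBasics.
Context (R : realType) (L : R).

Lemma circle_piP (a b : R) :
  circle_pi L a = circle_pi L b <-> exists k : int, a = b + k%:~R * L.
Proof.
have -> : circle_pi L a = circle_pi L b <-> a - b \in multiples L.
  rewrite /circle_pi; split=> [/eqP|h].
    by move=> e; rewrite Quotient.idealrBE; exact: e.
  by apply/eqP; rewrite Quotient.idealrBE in h; exact: h.
split=> [/asboolP[k /eqP]|[k ->]].
  by rewrite subr_eq addrC => /eqP ->; exists k.
by apply/asboolP; exists k; rewrite addrAC subrr add0r.
Qed.

Lemma circle_piD (a b : R) : circle_pi L (a + b) = circle_pi L a + circle_pi L b.
Proof. by rewrite /circle_pi; exact: (raddfD (\pi_(circle L))%qT). Qed.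

Lemma circle_pi_surj (p : circle L) : exists a, p = circle_pi L a.
Proof. by exists (repr p); rewrite /circle_pi reprK. Qed.

Lemma iter_rotation (M a : R) n :
  iter n (rotation M) (circle_pi L a) = circle_pi L (a + n%:R * M).
Proof.
elim: n => [|n IH]; first by rewrite mul0r addr0.
by rewrite iterS IH /rotation -circle_piD; congr circle_pi; rewrite -natr1; ring.
Qed.

Lemma fundamental_shift (x0 a : R) : 0 < L ->
  exists k : int, x0 <= a + k%:~R * L < x0 + L.
Proof.
move=> L0; exists (- Num.floor ((a - x0) / L)).
have := floor_le ((a - x0) / L); have := floorD1_gt ((a - x0) / L).
rewrite ler_pdivlMr// ltr_pdivrMr// intrD intrN => h1 h2.
by apply/andP; split; lra.
Qed.

Lemma fundamental_uniq (x0 u v : R) (k : int) : 0 < L ->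
  x0 <= u < x0 + L -> x0 <= v < x0 + L -> u = v + k%:~R * L -> k = 0.
Proof.
move=> L0 /andP[u1 u2] /andP[v1 v2] E.
have h1 : (-1)%:~R * L < k%:~R * L by rewrite intrN; lra.
have h2 : k%:~R * L < 1%:~R * L by lra.
by move: h1 h2; rewrite !ltr_pM2r// !ltr_int; case: k {E} => [[|?]|[|?]].
Qed.

End CircleBasics.

Lemma finite_gap (R : realType) (I : finType) (rho : I -> R) (z : R) :
  (forall i, rho i < z) -> exists2 v, v < z & forall i, rho i < v.
Proof.
move=> lt; case: (pickP (fun _ : I => true)) => [i0 _|noI]; last first.
  by exists (z - 1) => [|i]; [rewrite ltrBlDr ltrDl|have := noI i].
case: (@Order.TotalTheory.arg_maxP _ _ I i0 (fun=> true) rho) => // i _ imax.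
exists ((rho i + z) / 2) => [|j]; have := lt i; first lra.
have : rho j <= rho i by exact: imax.
lra.
Qed.

(** The union of two half-open intervals that meet is half-open. *)
Lemma maximal_half_open_meet (R : realType) (U J K : set R) (t : R) :
  maximal_in (@half_open R) U J -> maximal_in (@half_open R) U K ->
  J t -> K t -> J = K.
Proof.
move=> [[a [b [_ JE]]] JU Jmax] [[c [d [_ KE]]] KU Kmax].
have memJ u : J u <-> a <= u < b by rewrite JE /= in_itv.
have memK u : K u <-> c <= u < d by rewrite KE /= in_itv.
move=> /memJ/andP[at_ tb] /memK/andP[ct td].
pose S : set R := `[Num.min a c, Num.max b d[.
have memS u : S u <-> Num.min a c <= u < Num.max b d by rewrite /S /= in_itv.
have SH : half_open S.
  exists (Num.min a c), (Num.max b d); split=> //.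
  by rewrite lt_max; apply/orP; left; apply: le_lt_trans tb; rewrite ge_min at_.
have SU : S `<=` U.
  move=> u /memS; rewrite ge_min lt_max => /andP[h1 h2].
  have [ut|tu] := leP u t.
    case/orP: h1 => h1; [apply/JU/memJ|apply/KU/memK]; rewrite h1 /=;
      exact: le_lt_trans ut _.
  case/orP: h2 => h2; [apply/JU/memJ|apply/KU/memK]; rewrite h2 andbT;
    exact: le_trans (ltW tu).
transitivity S.
  apply/esym/Jmax => // u /memJ/andP[h1 h2].
  by apply/memS; rewrite ge_min lt_max h1 h2.
apply: Kmax => // u /memK/andP[h1 h2].
by apply/memS; rewrite ge_min lt_max h1 h2 !orbT.
Qed.

Section ExchangeSegments.
Context (R : realType) (A : finType) (sigma : {perm doubled A}).
Context (x : doubled A -> R).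
Hypothesis sigma_cycles : has_exchange_cycles sigma.
Hypothesis x_up : forall a, x (bg a) < x (sigma (bg a)).
Hypothesis x_down : forall a, x (sigma (en a)) < x (en a).

Lemma up_bg s : {in map (@bg A) s, forall r, x r < x (sigma r)}.
Proof. by move=> r /mapP[c _ ->]. Qed.

Lemma down_en s : {in map (@en A) s, forall r, x (sigma r) < x r}.
Proof. by move=> r /mapP[c _ ->]. Qed.

Lemma segment_ends C a b : exchange_cycle sigma C a b ->
  [/\ exists c, sigma (bg c) = en b, exists c, sigma (en c) = bg a,
      C = porbit sigma (bg a), bg a \in C /\ en b \in C & x (bg a) < x (en b)].
Proof.
move=> cyc; have [s [t [ps sE pt tE [CE CE']]]] := exchange_cycle_parts cyc.
split=> //; [by exists (last a s)|by exists (last b t)|split|].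
- by rewrite CE porbit_id.
- by rewrite CE' inE mem_cat (map_f (@en A) (mem_head _ _)) orbT.
have [_] := rising_path_ge ps (@up_bg (a :: s)) (mem_head _ _).
by rewrite last_map sE; apply: lt_le_trans.
Qed.

Lemma segment_beginning C a b u : exchange_cycle sigma C a b ->
  x (bg a) <= u < x (en b) <->
  exists2 c, bg c \in C & x (bg c) <= u < x (sigma (bg c)).
Proof.
move=> cyc; have [s [t [ps sE pt tE [CE CE']]]] := exchange_cycle_parts cyc.
split=> [u_in|[c cC /andP[cu uc]]].
  have [|r rs ru] := rising_path_cover (x := x) (u := u) ps; first by rewrite last_map sE.
  have /mapP[c cs rE] : r \in map (@bg A) (a :: s) by [].
  by exists c; rewrite -?rE// CE' inE mem_cat rs.
have {}cC : bg c \in map (@bg A) (a :: s).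
  by move: cC; rewrite CE' inE mem_cat => /orP[//|/mapP[]].
have [h1 h2] := rising_path_ge ps (@up_bg (a :: s)) cC.
rewrite last_map sE in h2.
by rewrite (le_trans h1 cu) (lt_le_trans uc h2).
Qed.

Lemma segment_ending C a b u : exchange_cycle sigma C a b ->
  x (bg a) <= u < x (en b) <->
  exists2 c, en c \in C & x (sigma (en c)) <= u < x (en c).
Proof.
move=> cyc; have [s [t [ps sE pt tE [CE CE']]]] := exchange_cycle_parts cyc.
split=> [u_in|[c cC /andP[cu uc]]].
  have [|r rs ru] := falling_path_cover (x := x) (u := u) pt; first by rewrite last_map tE.
  have /mapP[c cs rE] : r \in map (@en A) (b :: t) by [].
  by exists c; rewrite -?rE// CE' inE mem_cat rs orbT.
have {}cC : en c \in map (@en A) (b :: t).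
  by move: cC; rewrite CE' inE mem_cat => /orP[/mapP[]|].
have [h1 h2] := falling_path_le pt (@down_en (b :: t)) cC.
rewrite last_map tE in h2.
by rewrite (le_trans h2 cu) (lt_le_trans uc h1).
Qed.

Lemma segment_beginning_inj C a b c d u : exchange_cycle sigma C a b ->
  bg c \in C -> bg d \in C -> x (bg c) <= u < x (sigma (bg c)) ->
  x (bg d) <= u < x (sigma (bg d)) -> c = d.
Proof.
move=> cyc; have [s [t [ps sE pt tE [CE CE']]]] := exchange_cycle_parts cyc.
have mem e : bg e \in C -> bg e \in map (@bg A) (a :: s).
  by rewrite CE' inE mem_cat => /orP[//|/mapP[]].
move=> /mem cs /mem ds hc hd; apply: bg_inj.
exact: (rising_path_inj ps (@up_bg (a :: s)) cs ds hc hd).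
Qed.

Lemma segment_of c :
  exists a b, exchange_cycle sigma (porbit sigma c) a b.
Proof. by apply: sigma_cycles; exact: imset_f. Qed.

(** From here on, [U] is the union of the beginning intervals, and the segments
    do not touch each other. *)
Context (U : set R).
Hypothesis UE : forall u, U u <-> exists a, x (bg a) <= u < x (sigma (bg a)).
Hypothesis right_free : forall b d, sigma (bg d) = en b -> ~ U (x (en b)).
Hypothesis left_free : forall a d, sigma (en d) = bg a ->
  forall u, u < x (bg a) -> exists2 v, u <= v < x (bg a) & ~ U v.
Hypothesis left_inj : forall a b, x (bg a) = x (bg b) -> a = b.

Lemma exchange_segment_maximal (xf : {ffun doubled A -> R}) C J :
  xf =1 x -> exchange_segment sigma xf C J -> maximal_in (@half_open R) U J.
Proof.
move=> xfE [a [b [cyc]]]; rewrite !xfE => JE.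
have [[d db] [e ea] _ _ ab] := segment_ends cyc.
have memJ u : J u <-> x (bg a) <= u < x (en b) by rewrite JE /= in_itv.
have JU : J `<=` U.
  by move=> u /memJ /(segment_beginning _ cyc)[c _ cu]; apply/UE; exists c.
split=> //; first by exists (x (bg a)), (x (en b)).
move=> S [c1 [d1 [cd SE]]] SU JS; rewrite SE JE.
have memS u : S u <-> c1 <= u < d1 by rewrite SE /= in_itv.
have /memS/andP[c1a ad1] : S (x (bg a)) by apply/JS/memJ; rewrite lexx.
have c1E : c1 = x (bg a).
  apply/eqP; rewrite eq_le c1a leNgt; apply/negP => lt.
  have [v /andP[v1 v2] nv] := left_free ea lt.
  by apply: nv; apply/SU/memS; rewrite v1 (lt_trans v2).
have d1E : d1 = x (en b).
  apply/eqP; rewrite eq_le; apply/andP; split; rewrite leNgt; apply/negP => lt.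
    by apply: (right_free db); apply/SU/memS; rewrite lt c1E ltW.
  have : S d1 by apply/JS/memJ; rewrite lt ltW.
  by move=> /memS/andP[_]; rewrite ltxx.
by rewrite c1E d1E.
Qed.

Lemma maximal_exchange_segment (xf : {ffun doubled A -> R}) J :
  xf =1 x -> maximal_in (@half_open R) U J ->
  exists! C, exchange_segment sigma xf C J.
Proof.
move=> xfE Jmax; have [[c [d [cd JE]]] JU _] := Jmax.
have memJ u : J u <-> c <= u < d by rewrite JE /= in_itv.
have /JU/UE[e /andP[ec ce]] : J c by apply/memJ; rewrite lexx.
have [a [b cyc]] := segment_of (bg e).
have /(segment_beginning _ cyc) c_in :
    exists2 f, bg f \in porbit sigma (bg e) & x (bg f) <= c < x (sigma (bg f)).
  by exists e; rewrite ?porbit_id ?ec.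
pose K : set R := `[x (bg a), x (en b)[.
have memK u : K u <-> x (bg a) <= u < x (en b) by rewrite /K /= in_itv.
have segK : exchange_segment sigma xf (porbit sigma (bg e)) K.
  by exists a, b; rewrite !xfE.
have JK : J = K.
  apply: (maximal_half_open_meet Jmax (exchange_segment_maximal xfE segK) (t := c)).
    by apply/memJ; rewrite lexx.
  exact/memK.
exists (porbit sigma (bg e)); split; first by rewrite JK.
move=> C [a' [b' [cyc' JE']]]; rewrite !xfE in JE'.
have [_ _ CE _ ab'] := segment_ends cyc'.
have [_ _ CE0 _ ab] := segment_ends cyc.
rewrite CE CE0; congr (porbit _ (bg _)); apply: left_inj.
have mem' u : J u <-> x (bg a') <= u < x (en b') by rewrite JE' /= in_itv.
apply/eqP; rewrite eq_le; apply/andP; split.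
  by have /memK/andP[] : K (x (bg a')) by rewrite -JK; apply/mem'; rewrite lexx.
by have /mem'/andP[] : J (x (bg a)) by rewrite JK; apply/memK; rewrite lexx.
Qed.

End ExchangeSegments.

(** * Embedding an exchange in a rotation *)

Section Embedding.
Context (R : realType) (A : finType) (sigma : {perm doubled A}).
Context (w : doubled A -> R) (h n : doubled A -> int) (L M : R).
Context (g : doubled A -> R).
Hypothesis L_gt0 : 0 < L.
Hypothesis w_up : forall a, w (bg a) < w (sigma (bg a)).
Hypothesis w_closed : closed_cochain sigma w.
Hypothesis h_closed : closed_cochain sigma h.
Hypothesis h_up : forall a, 0 < height sigma h a.
Hypothesis n_h : pairing sigma n h = 1.
Hypothesis g_dual : invariant_under (dual sigma) g.
Hypothesis wE : forall p, w p = L * (n p)%:~R + M * (h p)%:~R + g p.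
Hypothesis sigma_cycles : has_exchange_cycles sigma.
Hypothesis h_facing : forall p q, facing_ends sigma p q -> h p != h q.

Let w_down a : w (sigma (en a)) < w (en a).
Proof. by rewrite -subr_gt0 -closed_widthE// subr_gt0. Qed.

Local Notation storey := (in_storey sigma w h L M).
Let unique := tower_unique L_gt0 w_up h_closed h_up n_h g_dual wE.

Definition lands (t : R) (a : A) (j : int) : bool :=
  w (bg a) <= t + j%:~R * L < w (sigma (bg a)).

Lemma landsE t a j : lands t a j = storey t a 0 j.
Proof. by rewrite /in_storey storeys_gt0// mul0r subr0. Qed.

Lemma lands_unique t a j b k : lands t a j -> lands t b k -> a = b /\ j = k.
Proof. by rewrite !landsE => H K; have [-> _ ->] := unique H K. Qed.

Lemma lands_shift t a j k : lands (t + k%:~R * L) a j = lands t a (k + j).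
Proof. by rewrite /lands intrD mulrDl addrA. Qed.

Lemma lands_left a : lands (w (bg a)) a 0.
Proof. by rewrite /lands mul0r addr0 lexx w_up. Qed.

(** The right end [en b], being the bottom right corner of the storeys over
    [d], is also the lower left corner of some storey, over [c] say. If it lies
    in a segment then this storey is at ground level, so [bg c] and [en b] have
    the same height. If [bg c] is a left end, the two ends are facing ends of
    equal height. Otherwise the letter before [c] and [d] overlap just left of
    this point. *)
Lemma right_end_free b d a j : sigma (bg d) = en b -> ~ lands (w (en b)) a j.
Proof.
move=> db H; pose Y := h (en b); pose s := dual sigma.
have dE : s (en d) = en b by rewrite /s dual_en.
(* Around a cycle of the dual, the heights cross the level [Y] upwards as often
   as downwards, and [en d] is a downward crossing. *)
have : \sum_(p in porbit s (en d))
    (((Y < h (s p))%R : nat)%:Z - ((Y < h p)%R : nat)%:Z) = 0.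
  rewrite sumrB [X in _ - X](reindex_inj (@perm_inj _ s)) /=.
  apply/eqP; rewrite subr_eq0; apply/eqP; apply: eq_bigl => p.
  by rewrite -!eq_porbit_mem porbit_step.
have Yd : Y < h (en d).
  by rewrite /Y -dE /s dual_en -subr_gt0 -closed_heightE.
case: (pselect (exists2 c, bg c \in porbit s (en d) & h (bg c) <= Y < h (s (bg c)))).
  move=> [c cD /andP[hc1 hc2]] _.
  have gE p : p \in porbit s (en d) -> g p = g (en d).
    by move=> /porbitP[i ->]; elim: i => [|i IH]; rewrite ?expg0 ?perm1// expgSr permM g_dual.
  have gb : g (en b) = g (en d) by rewrite -dE g_dual.
  pose k := `|(Y - h (bg c))%R|%N.
  have kE : k%:Z = Y - h (bg c) by rewrite /k gez0_abs// subr_ge0.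
  have Hc : storey (w (en b)) c k (n (bg c) - n (en b)).
    apply/andP; split.
      by rewrite -ltz_nat storeysE// kE /height ltrD2r -dual_bg.
    have -> : w (en b) - k%:R * M + (n (bg c) - n (en b))%:~R * L = w (bg c).
      rewrite [k%:R]pmulrn -/(intmul 1 k%:Z) kE !wE (gE _ cD) gb !intrB /Y; ring.
    by rewrite lexx w_up.
  move: H; rewrite landsE => H; have [ac k0 je] := unique H Hc.
  move: H; rewrite -landsE {a}ac je => H.
  have hY : h (bg c) = Y by apply/eqP; rewrite eq_sym -subr_eq0 -kE -k0.
  have wc : w (bg c) = w (en b) + j%:~R * L.
    by rewrite !wE hY (gE _ cD) gb je intrB /Y; ring.
  case E : (sigma^-1%g (bg c)) => [e []].
    suff : facing_ends sigma (bg c) (en b) by move/h_facing; rewrite hY eqxx.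
    by rewrite /facing_ends /= E -db permK.
  have ec : sigma (bg e) = bg c by rewrite /bg -E permKV.
  pose dl := Num.min (w (en b) - w (bg d)) (w (bg c) - w (bg e)).
  have dl0 : 0 < dl by rewrite lt_min !subr_gt0 -db -ec !w_up.
  have dl1 : dl <= w (en b) - w (bg d) by rewrite ge_min lexx.
  have dl2 : dl <= w (bg c) - w (bg e) by rewrite ge_min lexx orbT.
  have H1 : lands (w (en b) - dl) d 0.
    by rewrite /lands mul0r addr0 db; apply/andP; split; lra.
  have H2 : lands (w (en b) - dl) e j.
    rewrite /lands ec; have -> : w (en b) - dl + j%:~R * L = w (bg c) - dl.
      by rewrite wc; ring.
    by apply/andP; split; lra.
  have [de _] := lands_unique H1 H2.
  by move: ec; rewrite -de db.
move=> none; suff neg : \sum_(p in porbit s (en d))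
    (((Y < h (s p))%R : nat)%:Z - ((Y < h p)%R : nat)%:Z) < 0.
  by move=> E; rewrite E in neg.
rewrite (bigD1 (en d)) ?porbit_id//= dE ltxx Yd.
apply: (@le_lt_trans _ _ (- 1 + 0)) => //; apply: lerD => //.
apply: sumr_le0 => -[c []] /andP[cD _].
  have : h (s (en c)) < h (en c) by rewrite /s dual_en -subr_gt0 -closed_heightE.
  rewrite -/(en c); move=> lt2.
  have [lt|_] := ltP Y (h (s (en c))); last by case: (Y < _).
  by rewrite (lt_trans lt lt2).
rewrite -/(bg c) in cD *.
have [lt|] := ltP Y (h (s (bg c))); last by case: (Y < _).
have [//|le] := ltP Y (h (bg c)).
by case: none; exists c; rewrite ?le.
Qed.

(** A letter ending at [bg a] modulo [L] would be followed by a right end,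
    which lies in no segment, or by a beginning, hence by [bg a], whose predecessor is an
    ending. *)
Lemma left_end_gap a d : sigma (en d) = bg a ->
  exists2 v, v < w (bg a) & forall u, v < u < w (bg a) -> forall c j, ~ lands u c j.
Proof.
move=> da.
have /choice[k kP] (c : A) : exists k : int,
    w (bg a) - L <= w (sigma (bg c)) + k%:~R * L < w (bg a) - L + L.
  exact: fundamental_shift.
have [c|v va vP] := @finite_gap R A (fun c => w (sigma (bg c)) + (k c)%:~R * L) (w (bg a)).
  by have /andP[_] := kP c; rewrite subrK.
exists (Num.max v (w (bg a) - L)).
  by rewrite gt_max va ltrBlDr ltrDl.
move=> u /andP[]; rewrite gt_max => /andP[vu Lu] ua c j H.
have /andP[cu uc] := H.
pose e := w (sigma (bg c)) - j%:~R * L.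
have ue : u < e by rewrite /e; lra.
have [lt|gt|eq] := ltgtP e (w (bg a)).
- have E : w (sigma (bg c)) + (k c)%:~R * L = e + (k c + j)%:~R * L.
    by rewrite /e intrD; ring.
  have := kP c => kin.
  have k0 : k c + j = 0.
    by apply: fundamental_uniq E => //; apply/andP; split; lra.
  have := vP c; rewrite E k0 mul0r addr0; lra.
- have H' : lands (w (bg a)) c j.
    by apply/andP; rewrite /e in gt; split; lra.
  have [ca j0] := lands_unique (lands_left a) H'.
  by move: cu; rewrite -ca -j0 mul0r addr0; lra.
- have {}eq : w (sigma (bg c)) = w (bg a) + j%:~R * L by rewrite -eq /e; ring.
  case E : (sigma (bg c)) eq => [b []]; rewrite -?/(en b) -?/(bg b) => eq.
    apply: (@right_end_free b c a (- j) E).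
    by rewrite eq /lands intrN mulNr addrK lexx w_up.
  have H' : lands (w (bg a)) b j by rewrite /lands -eq lexx w_up.
  have [ab _] := lands_unique (lands_left a) H'.
  by have := perm_inj (etrans da (etrans (congr1 _ ab) (esym E))).
Qed.

(** Storeys above ground level avoid the segments; leaving the top storey means
    landing on the ending interval. *)
Lemma lands_lift u a : w (bg a) <= u < w (sigma (bg a)) ->
  (forall i : nat, (0 < i < storeys sigma h a)%N ->
     forall b j, ~ lands (u + i%:R * M) b j) /\
  exists j : int, u + (storeys sigma h a)%:R * M =
     u - w (bg a) + w (sigma (en a)) + j%:~R * L.
Proof.
move=> ua; split.
  move=> i /andP[i0 ia] b j; rewrite landsE => H.
  have H' : storey (u + i%:R * M) a i 0.
    by rewrite /in_storey ia mul0r addr0 addrK.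
  by have [_ E _] := unique H H'; rewrite -E in i0.
exists (n (bg a) - n (sigma (en a))).
have -> : (storeys sigma h a)%:R = (height sigma h a)%:~R :> R.
  by rewrite -storeysE.
have := g_dual (bg a); rewrite dual_bg !wE /height !intrB => ->; ring.
Qed.

Definition shadow : set (circle L) :=
  circle_pi L @` [set u | exists a, w (bg a) <= u < w (sigma (bg a))].

Lemma shadowP t : shadow (circle_pi L t) <-> exists a j, lands t a j.
Proof.
split=> [[u [a ua] /circle_piP[k uE]]|[a [j H]]].
  by exists a, k; rewrite /lands -uE.
exists (t + j%:~R * L); first by exists a.
by apply/circle_piP; exists j.
Qed.

Lemma return_at_top u a : w (bg a) <= u < w (sigma (bg a)) ->
  returns_at (rotation M) shadow (circle_pi L u) (storeys sigma h a) /\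
  first_return_map (rotation M) shadow (circle_pi L u) =
    circle_pi L (u - w (bg a) + w (sigma (en a))).
Proof.
move=> ua; have [inner [j top]] := lands_lift ua.
have topE : iter (storeys sigma h a) (rotation M) (circle_pi L u) =
    circle_pi L (u - w (bg a) + w (sigma (en a))).
  by rewrite iter_rotation; apply/circle_piP; exists j.
have ret : returns_at (rotation M) shadow (circle_pi L u) (storeys sigma h a).
  rewrite /returns_at storeys_gt0//=; apply/asboolP; rewrite topE.
  have [b [c cyc]] := segment_of sigma_cycles (en a).
  have : w (bg b) <= u - w (bg a) + w (sigma (en a)) < w (en c).
    apply/(segment_ending w_down _ cyc); exists a; first exact: porbit_id.
    have := closed_widthE a w_closed; rewrite /width => E.
    by have /andP[? ?] := ua; apply/andP; split; lra.
  move/(segment_beginning w_up _ cyc) => [d _ dP]; apply/shadowP.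
  by exists d, 0; rewrite /lands mul0r addr0.
split=> //; rewrite /first_return_map; case: pselect => [ex|[]]; last by eexists; exact: ret.
case: ex_minnP => m /andP[m0 /asboolP]; rewrite iter_rotation => /shadowP[b [k bk]] mmin.
suff -> : m = storeys sigma h a by rewrite -iter_rotation.
apply/eqP; rewrite eqn_leq mmin//= leqNgt; apply/negP => lt.
by apply: (inner m _ b k bk); rewrite m0.
Qed.

Lemma shadow_arcs : (0 < #|A|)%N -> union_of_arcs shadow.
Proof.
case E : #|A| => [//|k] _.
pose l (i : 'I_k.+1) : A := enum_val (cast_ord (esym E) i).
exists k, (fun i => circle_pi L @` `[w (bg (l i)), w (sigma (bg (l i)))[); split.
  move=> i; exists (w (bg (l i))), (w (sigma (bg (l i)))); split=> //.
  rewrite leNgt; apply/negP => lt.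
  have H : lands (w (bg (l i))) (l i) 1.
    by rewrite /lands mul1r lt andbT lerDl ltW.
  by have [] := lands_unique (lands_left (l i)) H.
apply/seteqP; split=> [p [u [a ua] <-]|p [i _ [u + <-]]].
  exists (cast_ord E (enum_rank a)) => //; exists u => //.
  by rewrite /l cast_ordK enum_rankK /= in_itv.
by rewrite /= in_itv => ui; exists u => //; exists (l i).
Qed.

Lemma shadow_admissible a d : sigma (en d) = bg a -> admissible shadow (w (bg a)).
Proof.
move=> da _ S [_ SG _]; rewrite /interior /= => SN.
have /(_ _ SN) := @pi_continuous R (circle L) (w (bg a)).
rewrite nbhs_filterE => -[e /= e0 he].
have [v va vP] := left_end_gap da.
pose u := Num.max ((v + w (bg a)) / 2) (w (bg a) - e / 2).
have u1 : v < u by rewrite lt_max; apply/orP; left; lra.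
have u2 : u < w (bg a) by rewrite gt_max; apply/andP; split; lra.
have u3 : w (bg a) - e / 2 <= u by rewrite le_max lexx orbT.
have /SG /shadowP[c [j]] : S (circle_pi L u).
  by apply: he; rewrite /ball_ /= ltr_norml; apply/andP; split; lra.
by apply: vP; rewrite u1.
Qed.

(** The fundamental domain starts at the left end of a segment. Moving each
    segment by a multiple of [L] into it does not cut any segment, since its
    starting point lies in no other segment. *)
Lemma embedded_exchange : (0 < #|A|)%N -> exchange_scheme R sigma ->
  exists (x0 : R) (x : {ffun doubled A -> R}),
    [/\ admissible shadow x0, first_return_is_exchange M shadow x0 sigma x
      & forall a, lengths sigma x a = width sigma w a].
Proof.
move=> A0 sigma_exch.
case: (pickP (fun _ : A => true)) => [c0 _|noA]; last by move: A0; rewrite eq_card0.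
have [a1 [b1 cyc1]] := segment_of sigma_cycles (bg c0).
have [_ [d1 da1] _ _ _] := segment_ends w_up cyc1.
pose x0 := w (bg a1).
have first_uniq C a b a' b' : exchange_cycle sigma C a b ->
    exchange_cycle sigma C a' b' -> a = a'.
  move=> cyc cyc'; have [_ [d da] _ [aC _] _] := segment_ends w_up cyc.
  exact: exchange_cycle_first cyc' aC da.
have /choice[m mP] (C : {set doubled A}) : exists k : int, forall a b,
    exchange_cycle sigma C a b -> x0 <= w (bg a) + k%:~R * L < x0 + L.
  case: (pselect (exists a b, exchange_cycle sigma C a b)) => [[a [b cyc]]|no].
    have [k kP] := fundamental_shift x0 (w (bg a)) L_gt0.
    by exists k => a' b' /(first_uniq _ _ _ _ _ cyc) <-.
  by exists 0 => a b cyc; case: no; exists a, b.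
pose q p : R := (m (porbit sigma p))%:~R * L.
have qs : invariant_under sigma q by move=> p; rewrite /q porbit_step.
pose x := [ffun p => w p + q p] : {ffun doubled A -> R}.
have xE : x =1 w \+ q by move=> p; rewrite ffunE.
have xc : closed_cochain sigma x.
  apply: (closed_ext (fun p => esym (xE p))); apply: closedD => //.
  exact: invariant_closed.
have xw a : lengths sigma x a = width sigma w a.
  by rewrite /width !ffunE qs; ring.
have x_up a : x (bg a) < x (sigma (bg a)) by rewrite !xE /= qs ltrD2r.
have x_down a : x (sigma (en a)) < x (en a) by rewrite !xE /= qs ltrD2r.
have xlands u a : (x (bg a) <= u < x (sigma (bg a))) =
    lands u a (- m (porbit sigma (bg a))).
  by rewrite /lands !xE /= qs /q intrN mulNr lerBrDr ltrBlDr.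
have fund a u : x (bg a) <= u < x (sigma (bg a)) -> x0 <= u < x0 + L.
  move=> ua; have [a2 [b2 cyc]] := segment_of sigma_cycles (bg a).
  have [_ [d2 da2] CE [a2C _] _] := segment_ends w_up cyc.
  have /(segment_beginning x_up _ cyc)/andP[u1 u2] :
    exists2 c, bg c \in porbit sigma (bg a) & x (bg c) <= u < x (sigma (bg c)).
    by exists a; rewrite ?porbit_id.
  have := mP _ _ _ cyc; rewrite CE.
  have -> : w (bg a2) + (m (porbit sigma (bg a2)))%:~R * L = x (bg a2) by rewrite xE.
  move=> /andP[l1 l2]; rewrite (le_trans l1 u1)/=; apply: lt_le_trans u2 _.
  rewrite leNgt; apply/negP => gt.
  have /(segment_beginning x_up _ cyc)[c cC] : x (bg a2) <= x0 + L < x (en b2).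
    by rewrite ltW.
  rewrite xlands -[X in _ + X]mul1r -[1]/(1%:~R) lands_shift => H.
  have [ac E] := lands_unique (lands_left a1) H.
  have : a1 = a2 by apply: (exchange_cycle_first cyc _ da1); rewrite ac.
  move=> a12; move: l2; rewrite xE /= -/(q _) /q -CE.
  have -> : porbit sigma (bg a) = porbit sigma (bg c).
    by apply/eqP; rewrite eq_sym eq_porbit_mem.
  have -> : m (porbit sigma (bg c)) = 1 by apply/eqP; rewrite eq_sym -subr_eq0 -E.
  by rewrite -a12 mul1r ltxx.
have UE u : unroll shadow x0 u <-> exists a, x (bg a) <= u < x (sigma (bg a)).
  split=> [[/= +] /shadowP[a [j aj]]|[a ua]].
    rewrite in_itv => u_in; exists a; rewrite xlands.
    pose v := u + j%:~R * L + q (bg a).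
    have va : x (bg a) <= v < x (sigma (bg a)).
      by rewrite !xE /= qs /v lerD2r ltrD2r.
    have jm : j + m (porbit sigma (bg a)) = 0.
      apply: (fundamental_uniq L_gt0 (fund _ _ va) u_in).
      by rewrite /v /q intrD; ring.
    by move: aj; rewrite (_ : j = - m (porbit sigma (bg a)))//; apply/eqP; rewrite -addr_eq0 jm.
  split; first by rewrite /= in_itv; exact: fund ua.
  by apply/shadowP; exists a; rewrite xlands in ua; exists (- m (porbit sigma (bg a))).
have right_free b d : sigma (bg d) = en b -> ~ unroll shadow x0 (x (en b)).
  move=> db [_ /shadowP[a [j]]]; rewrite xE /= /q lands_shift.
  exact: right_end_free db.
have left_free a d : sigma (en d) = bg a -> forall u, u < x (bg a) ->
    exists2 v, u <= v < x (bg a) & ~ unroll shadow x0 v.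
  move=> da u ua; have [v va vP] := left_end_gap da.
  move: ua; rewrite xE /= => ua.
  pose v' := Num.max u ((v + w (bg a)) / 2 + q (bg a)).
  have v1 : u <= v' by rewrite le_max lexx.
  have v2 : v' < w (bg a) + q (bg a) by rewrite gt_max ua; lra.
  have v3 : (v + w (bg a)) / 2 + q (bg a) <= v' by rewrite le_max lexx orbT.
  exists v'; first by rewrite v1.
  case=> _ /shadowP[c [j]].
  rewrite -[v'](subrK (q (bg a))) /q lands_shift -/(q _).
  by apply: vP; rewrite -/(q (bg a)); apply/andP; split; lra.
have left_inj a b : x (bg a) = x (bg b) -> a = b.
  move=> E; have : x (bg b) <= x (bg a) < x (sigma (bg b)) by rewrite E lexx x_up.
  have : x (bg a) <= x (bg a) < x (sigma (bg a)) by rewrite lexx x_up.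
  by rewrite !xlands => H H'; have [] := lands_unique H H'.
have pi_shift u a : circle_pi L (u + q a) = circle_pi L u.
  by apply/circle_piP; exists (m (porbit sigma a)).
have forward y z : exchange_graph sigma x y z ->
    first_return_map (rotation M) shadow (circle_pi L y) = circle_pi L z.
  move=> [a [+ _ E]]; rewrite /beginning_interval /= in_itv /= => ya.
  have ya' : w (bg a) <= y - q (bg a) < w (sigma (bg a)).
    by move: ya; rewrite !xE /= qs lerBrDr ltrBlDr.
  have [_] := return_at_top ya'.
  have -> : circle_pi L (y - q (bg a)) = circle_pi L y.
    by rewrite -[in RHS](subrK (q (bg a)) y) pi_shift.
  move=> ->; have -> : z = y - q (bg a) - w (bg a) + w (sigma (en a)) + q (en a).
    by rewrite -[z](subrK (x (sigma (en a)))) E !xE /= qs; ring.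
  by rewrite pi_shift.
exists x0, x; split=> //; first exact: shadow_admissible da1.
split.
- split=> // [a|a]; last by rewrite xw subr_gt0.
  by have := closed_widthE a xc; rewrite /width.
- move=> p; have [t ->] := circle_pi_surj p => /shadowP[a [j aj]].
  have [ret _] := return_at_top aj; exists (storeys sigma h a).
  by rewrite -(_ : circle_pi L (t + j%:~R * L) = circle_pi L t)//; apply/circle_piP; exists j.
- move=> C J; exact: (exchange_segment_maximal x_up UE right_free left_free).
- move=> J; exact: (maximal_exchange_segment sigma_cycles x_up UE right_free left_free left_inj).
move=> y z yU zU; split; first exact: forward.
have /UE[a ya] := yU.
pose z' := y - x (bg a) + x (sigma (en a)).
have z'a : x (sigma (en a)) <= z' < x (en a).
  have := closed_widthE a xc; rewrite /width /z' => E.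
  by have /andP[? ?] := ya; apply/andP; split; lra.
have yz' : exchange_graph sigma x y z'.
  exists a; split; rewrite /beginning_interval /ending_interval /= ?in_itv//.
  by rewrite /z'; ring.
rewrite (forward _ _ yz') => /circle_piP[k zE].
have z'U : x0 <= z' < x0 + L.
  have [a2 [b2 cyc]] := segment_of sigma_cycles (en a).
  have : x (bg a2) <= z' < x (en b2).
    apply/(segment_ending x_down _ cyc); exists a => //; exact: porbit_id.
  by move/(segment_beginning x_up _ cyc) => [c _ /fund].
have [/= + _] := zU; rewrite in_itv /= => z_in.
have k0 := fundamental_uniq L_gt0 z'U z_in zE.
by move: zE; rewrite k0 mul0r addr0 => <-.
Qed.

End Embedding.

(** * Realization of rotational schemes *)

Lemma allowed_closed (R : realType) (A : finType) (sigma : {perm doubled A})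
    (x : {ffun doubled A -> R}) :
  allowed_endpoints sigma x -> closed_cochain sigma x.
Proof.
by move=> xa a; have /eqP := xa a; rewrite subr_eq addrAC => /eqP ->; rewrite subrK addrC.
Qed.

Section Realization.
Context (R : realType) (A : finType) (sigma : {perm doubled A}).

(** In the coordinates of [closed_heights], a cocycle with positive widths is a
    multiple of [h] modulo [L] and coboundaries, so one step of the rotation by
    that multiple climbs one unit of height. *)
Lemma realize_on_circle (h h' : doubled A -> int) (z f g : doubled A -> R) (M : R) :
  let L := pairing sigma z (fun p => (h p)%:~R) in
  (0 < #|A|)%N -> exchange_scheme R sigma ->
  closed_cochain sigma h -> (forall a, 0 < height sigma h a) ->
  (forall p q, facing_ends sigma p q -> h p != h q) ->
  pairing sigma h' h = 1 ->
  closed_cochain sigma z -> (forall a, 0 < width sigma z a) ->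
  invariant_under sigma f -> invariant_under (dual sigma) g ->
  (forall p, z p = L * (h' p)%:~R + M * (h p)%:~R + f p + g p) ->
  exists (Gamma : set (circle L)) (x0 : R) (x : {ffun doubled A -> R}),
    [/\ 0 < L, union_of_arcs Gamma, admissible Gamma x0,
        first_return_is_exchange M Gamma x0 sigma x
      & forall a, lengths sigma x a = width sigma z a].
Proof.
move=> L A0 sch hc hh hf h'h zc zw fs gd zE.
have L0 : 0 < L.
  case: (pickP (fun _ : A => true)) => [a0 _|noA]; last by move: A0; rewrite eq_card0.
  rewrite /L /pairing (bigD1 a0)//= ltr_wpDr ?sumr_ge0//.
    by move=> a _; rewrite mulr_ge0 ?ltW ?height_intr ?ltr0z.
  by rewrite mulr_gt0 ?height_intr ?ltr0z.
pose w := z \- f.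
have wc : closed_cochain sigma w by apply: closedB => //; exact: invariant_closed.
have ww a : width sigma w a = width sigma z a by rewrite /width /w /= fs; ring.
have wup a : w (bg a) < w (sigma (bg a)) by rewrite -subr_gt0 -/(width _ _ _) ww.
have wE p : w p = L * (h' p)%:~R + M * (h p)%:~R + g p by rewrite /w /= zE; ring.
have hs : has_exchange_cycles sigma := sch.2.
have [x0 [x [adm fr xw]]] := embedded_exchange L0 wup wc hc hh h'h gd wE hs hf A0 sch.
exists (@shadow R A sigma w L), x0, x; split=> //; last by move=> a; rewrite xw.
exact: (shadow_arcs L0 wup hc hh h'h gd wE).
Qed.

Lemma rotational_heights : (0 < #|A|)%N -> irreducible_scheme sigma ->
  rotational_scheme R sigma ->
  exists h h' : doubled A -> int,
    [/\ closed_cochain sigma h, forall a, 0 < height sigma h a,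
        forall p q, facing_ends sigma p q -> h p != h q, pairing sigma h' h = 1
      & forall z : doubled A -> R, closed_cochain sigma z ->
        exists M f g, [/\ invariant_under sigma f, invariant_under (dual sigma) g
        & forall p, z p = pairing sigma z (fun p => (h p)%:~R) * (h' p)%:~R
             + M * (h p)%:~R + f p + g p]].
Proof.
move=> A0 irr [[[v [[x [xa xv]] v0]] hs] [[v' [[y [ya yv']] v'0]] hd]].
apply: (closed_heights (x := x) (y := y)) => //.
- exact: allowed_closed.
- by move=> a; have := v0 a; rewrite -xv ffunE.
- have yc := allowed_closed ya.
  by move=> a; have := yc a; rewrite dual_bg dual_en addrC.
- by move=> a; have := v'0 a; rewrite -yv' ffunE dual_bg.
Qed.

End Realization.

Lemma irrational_shift (R : realType) (L M : R) : 0 < L ->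
  exists2 c : R, 0 <= c & forall n : nat, irrational ((M + c / n.+1%:R) / L).
Proof.
move=> L0; have Ln := lt0r_neq0 L0.
case: (pselect (rational (M / L))) => [/rationalP[p [q E]]|irr]; last first.
  by exists 0 => // n; rewrite mul0r addr0.
exists (L * pi); first by rewrite mulr_ge0 ?ltW ?pi_gt0.
move=> n /rationalP[p' [q' E']].
apply: (@pi_irrationnal R); apply/rationalP.
have piE : pi = n.+1%:R * (p'%:~R / q'%:R - p%:~R / q%:R) :> R.
  rewrite -E -E'; have : n.+1%:R != 0 :> R by rewrite pnatr_eq0.
  by move: (n.+1%:R) => k k0; field; rewrite Ln k0.
have [q0|q0] := eqVneq q 0%N; have [q'0|q'0] := eqVneq q' 0%N.
- by have := pi_gt0 R; rewrite piE q0 q'0 invr0 !mulr0 subrr mulr0 ltxx.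
- exists (n.+1%:Z * p')%R, q'; rewrite piE q0 invr0 intrM -pmulrn; ring.
- exists (- (n.+1%:Z * p))%R, q; rewrite piE q'0 invr0 intrN intrM -pmulrn; ring.
exists (n.+1%:Z * (p' * q%:Z - p * q'%:Z))%R, (q * q')%N.
rewrite piE natrM intrM intrB !intrM -!pmulrn; field.
by rewrite !pnatr_eq0 q0 q'0.
Qed.

Lemma rotational_realization (R : realType) (A : finType)
    (sigma : {perm doubled A}) (x : {ffun doubled A -> R}) :
  (0 < #|A|)%N -> interval_exchange sigma x ->
  irreducible_scheme sigma -> rotational_scheme R sigma ->
  exists (L M : R) (Gamma : set (circle L)) (x0 : R) (x' : {ffun doubled A -> R}),
     [/\ 0 < L, union_of_arcs Gamma, admissible Gamma x0,
       first_return_is_exchange M Gamma x0 sigma x'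
       & lengths sigma x' = lengths sigma x].
Proof.
move=> A0 [sch xa xl] irr rot.
have [h [h' [hc hh hf h'h span]]] := rotational_heights A0 irr rot.
have xc := allowed_closed xa.
have xw a : 0 < width sigma x a by have := xl a; rewrite ffunE.
have [M [f [g [fs gd zE]]]] := span x xc.
have [Gamma [x0 [x' [L0 un adm fr len]]]] :=
  realize_on_circle A0 sch hc hh hf h'h xc xw fs gd zE.
exists (pairing sigma x (fun p => (h p)%:~R)), M, Gamma, x0, x'; split=> //.
by apply/ffunP => a; rewrite len ffunE.
Qed.

(** Adding a small multiple of [h] to the endpoints changes the angle of the
    rotation but not the length of the circle. *)
Lemma rotational_irrational_realization (R : realType) (A : finType)
    (sigma : {perm doubled A}) :
  (0 < #|A|)%N -> irreducible_scheme sigma -> rotational_scheme R sigma ->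
  exists (L M : R) (Gamma : set (circle L)) (x0 : R),
      [/\ 0 < L, irrational (M / L), union_of_arcs Gamma, admissible Gamma x0
        & exists x : {ffun doubled A -> R},
            first_return_is_exchange M Gamma x0 sigma x].
Proof.
move=> A0 irr rot; have [sch _] := rot; have [[v [[x [xa xv]] v0]] _] := sch.
have [h [h' [hc hh hf h'h span]]] := rotational_heights A0 irr rot.
have xc := allowed_closed xa.
have xw a : 0 < width sigma x a by have := v0 a; rewrite -xv ffunE.
have [M [f [g [fs gd zE]]]] := span x xc.
pose hR p : R := (h p)%:~R.
have hRc : closed_cochain sigma hR by exact: closed_intr.
pose L := pairing sigma x hR.
have [_ [_ [_ [L0 _ _ _ _]]]] := realize_on_circle A0 sch hc hh hf h'h xc xw fs gd zE.
have [c _ cP] := irrational_shift M L0.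
have [N NP] := eventually_dominates (width sigma x) (fun a => c * width sigma hR a).
pose e := c / N.+1%:R.
pose z := (x : doubled A -> R) \+ (fun p => e * hR p).
have zc : closed_cochain sigma z by apply: closedD => //; exact: closedZ.
have zw a : 0 < width sigma z a.
  have -> : width sigma z a = width sigma x a + e * width sigma hR a.
    by rewrite /width /z /=; ring.
  have := NP N.+1 a (leqnSn _) (lt0r_neq0 (xw a)).
  rewrite (gtr0_norm (xw a)) ltr_norml => /andP[h1 _].
  have N0 : 0 < N.+1%:R :> R by rewrite ltr0n.
  rewrite -(pmulr_rgt0 _ N0); have -> : N.+1%:R * (width sigma x a + e * width sigma hR a)
     = N.+1%:R * width sigma x a + c * width sigma hR a.
    by move: N0; rewrite /e; move: (N.+1%:R) => k k0; field; exact: lt0r_neq0.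
  lra.
have zL : pairing sigma z hR = L.
  rewrite pairingDl pairingZl -/L pairing_self//.
  by rewrite mulr0 addr0.
have zE' p : z p = pairing sigma z hR * (h' p)%:~R + (M + e) * (h p)%:~R + f p + g p.
  by rewrite zL /z /= zE -/hR -/L /hR; ring.
have [Gamma [x0 [x' [L0' un adm fr len]]]] :=
  realize_on_circle A0 sch hc hh hf h'h zc zw fs gd zE'.
exists (pairing sigma z hR), (M + e), Gamma, x0; split=> //; last by exists x'.
by rewrite zL; exact: cP.
Qed.

(** * Exchanges induced by irrational rotations *)

Section IrrationalRotation.
Context (R : realType) (L M : R).
Hypothesis L_gt0 : 0 < L.
Hypothesis ML_irr : irrational (M / L).

Lemma irrational_integer_relation (i j : int) : i%:~R * M = j%:~R * L -> i = 0.
Proof.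
move=> E; apply/eqP; apply: contraT => i0; case: ML_irr; apply/rationalP.
have Ln := lt0r_neq0 L_gt0.
have iR : i%:~R != 0 :> R by rewrite intr_eq0.
have -> : M / L = j%:~R / i%:~R.
  by apply/eqP; rewrite eqr_div// mulrC E.
case: (i) iR => k kR.
  by exists j, k; rewrite pmulrn.
by exists (- j), k.+1; rewrite NegzE intrN intrN invrN mulrN mulNr pmulrn.
Qed.

(** Some multiple of [M] is closer to [L Z] than the length of the arc; its
    multiples cannot jump over the arc. *)
Lemma irrational_orbit_hits (c d : R) : c < d ->
  exists K : nat, forall u, exists n (j : int),
    (0 < n <= K)%N /\ c <= u + n%:R * M + j%:~R * L < d.
Proof.
move=> cd; have Ln := lt0r_neq0 L_gt0.
pose Q := Num.trunc (L / (d - c)).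
have [N N0 [P PE]] := @simultaneous_dirichlet R unit (fun=> M / L) Q.
pose dl := N%:R * M - (P tt)%:~R * L.
have dc : 0 < d - c by rewrite subr_gt0.
have dl_small : `|dl| < d - c.
  have := PE tt; have -> : N%:R * (M / L) - (P tt)%:~R = dl / L.
    by rewrite /dl; field.
  rewrite normrM [`|L^-1|]gtr0_norm ?invr_gt0// => h.
  have hQ : L < (d - c) * Q.+1%:R.
    by rewrite mulrC -ltr_pdivrMr// truncnS_gt.
  have : `|dl| * Q.+1%:R < L.
    by move: h; rewrite mulrAC ltr_pdivrMr// mul1r.
  by move=> /lt_trans/(_ hQ); rewrite ltr_pM2r.
have dl0 : dl != 0.
  rewrite subr_eq0; apply/eqP; rewrite pmulrn => /irrational_integer_relation /eqP.
  by rewrite eqz_nat; case: (N) N0.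
have ndl0 : 0 < `|dl| by rewrite normr_gt0.
exists (N * (Num.trunc (L / `|dl|)).+1)%N => u.
have finish t (k : int) : 0 <= t -> t <= L / `|dl| ->
    (forall i : nat, t < i%:R -> i%:R <= t + 1 -> c <= u + k%:~R * L + i%:R * dl < d) ->
    exists n (j : int), (0 < n <= N * (Num.trunc (L / `|dl|)).+1)%N /\
      c <= u + n%:R * M + j%:~R * L < d.
  move=> t0 tL H; pose i := (Num.trunc t).+1.
  exists (N * i)%N, (k - i%:Z * P tt); split.
    by rewrite muln_gt0 N0 /= leq_mul2l ltnS le_truncn ?orbT.
  have -> : u + (N * i)%:R * M + (k - i%:Z * P tt)%:~R * L = u + k%:~R * L + i%:R * dl.
    by rewrite /dl natrM intrB intrM -pmulrn; ring.
  apply: H; first exact: truncnS_gt.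
  by rewrite /i -natr1 lerD2r truncn_le.
have [k /andP[k1 k2]] := fundamental_shift (if 0 < dl then c - L else d) u L_gt0.
have [pos|neg] := ltP 0 dl.
  rewrite pos in k1 k2; rewrite (gtr0_norm pos) in dl_small finish *.
  apply: (finish ((c - (u + k%:~R * L)) / dl) k).
  - by apply: divr_ge0; lra.
  - by rewrite ler_pM2r ?invr_gt0//; lra.
  move=> i; rewrite ltr_pdivrMr// => h1.
  have -> : (c - (u + k%:~R * L)) / dl + 1 = (c - (u + k%:~R * L) + dl) / dl.
    by field.
  by rewrite ler_pdivlMr// => h2; apply/andP; split; lra.
have {}neg : dl < 0 by rewrite lt_neqAle dl0.
rewrite ltNge (ltW neg) /= in k1 k2; rewrite (ltr0_norm neg) in dl_small ndl0 finish *.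
apply: (finish ((u + k%:~R * L - d) / - dl) k).
- by apply: divr_ge0; lra.
- by rewrite ler_pM2r ?invr_gt0//; lra.
move=> i; rewrite ltr_pdivrMr// => h1.
have -> : (u + k%:~R * L - d) / - dl + 1 = (u + k%:~R * L - d - dl) / - dl.
  by field.
by rewrite ler_pdivlMr// => h2; apply/andP; split; lra.
Qed.

End IrrationalRotation.

Section ReturnExchange.
Context (R : realType) (L M : R) (Gamma : set (circle L)) (x0 : R).
Context (A : finType) (sigma : {perm doubled A}) (x : {ffun doubled A -> R}).
Hypothesis L_gt0 : 0 < L.
Hypothesis ML_irr : irrational (M / L).
Hypothesis fr : first_return_is_exchange M Gamma x0 sigma x.

Let sigma_cycles : has_exchange_cycles sigma.
Proof. by have [[[_ ?] _ _] _ _ _ _] := fr. Qed.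

Let x_closed : closed_cochain sigma x.
Proof. by have [[_ xa _] _ _ _ _] := fr; exact: allowed_closed. Qed.

Let x_up a : x (bg a) < x (sigma (bg a)).
Proof. by have [[_ _ xl] _ _ _ _] := fr; have := xl a; rewrite ffunE subr_gt0. Qed.

Let x_down a : x (sigma (en a)) < x (en a).
Proof. by rewrite -subr_gt0 -closed_widthE// subr_gt0. Qed.

Local Notation U := (unroll Gamma x0).

Lemma segment_in_unroll c a b u : exchange_cycle sigma (porbit sigma c) a b ->
  x (bg a) <= u < x (en b) -> U u.
Proof.
move=> cyc u_in; have [_ _ segmax _ _] := fr.
have [|_ + _] := segmax (porbit sigma c) `[x (bg a), x (en b)[; first by exists a, b.
by apply; rewrite /= in_itv.
Qed.

Lemma beginning_in_unroll a u : x (bg a) <= u < x (sigma (bg a)) -> U u.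
Proof.
move=> ua; have [c [d cyc]] := segment_of sigma_cycles (bg a).
apply: (segment_in_unroll cyc); apply/(segment_beginning x_up _ cyc).
by exists a; first exact: porbit_id.
Qed.

Lemma ending_to_beginning a u : x (sigma (en a)) <= u < x (en a) ->
  exists2 c, bg c \in porbit sigma (en a) & x (bg c) <= u < x (sigma (bg c)).
Proof.
move=> ua; have [c [d cyc]] := segment_of sigma_cycles (en a).
apply/(segment_beginning x_up _ cyc)/(segment_ending x_down _ cyc).
by exists a; first exact: porbit_id.
Qed.

(** Segments that meet are equal by maximality, and a segment has one cycle. *)
Lemma beginnings_disjoint a b u : x (bg a) <= u < x (sigma (bg a)) ->
  x (bg b) <= u < x (sigma (bg b)) -> a = b.
Proof.
move=> ua ub; have [_ _ segmax maxseg _] := fr.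
have [a1 [a2 cyca]] := segment_of sigma_cycles (bg a).
have [b1 [b2 cycb]] := segment_of sigma_cycles (bg b).
pose J (c d : A) : set R := `[x (bg c), x (en d)[.
have segJ : exchange_segment sigma x (porbit sigma (bg a)) (J a1 a2) by exists a1, a2.
have segK : exchange_segment sigma x (porbit sigma (bg b)) (J b1 b2) by exists b1, b2.
have JK : J a1 a2 = J b1 b2.
  apply: (maximal_half_open_meet (segmax _ _ segJ) (segmax _ _ segK) (t := u)).
    rewrite /J /= in_itv; apply/(segment_beginning x_up _ cyca).
    by exists a; first exact: porbit_id.
  rewrite /J /= in_itv; apply/(segment_beginning x_up _ cycb).
  by exists b; first exact: porbit_id.
have [C [_ Cuniq]] := maxseg _ (segmax _ _ segJ).
have CE : porbit sigma (bg a) = porbit sigma (bg b).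
  by rewrite -(Cuniq _ segJ); apply: Cuniq; rewrite JK.
apply: (segment_beginning_inj x_up cyca _ _ ua ub); first exact: porbit_id.
by rewrite CE porbit_id.
Qed.

Lemma unroll_fund u : U u -> x0 <= u < x0 + L.
Proof. by case; rewrite /= in_itv. Qed.

Lemma unroll_mod u v (k : int) : U u -> U v -> u = v + k%:~R * L -> u = v.
Proof.
move=> /unroll_fund u_in /unroll_fund v_in E.
by rewrite E (fundamental_uniq L_gt0 u_in v_in E) mul0r addr0.
Qed.

Lemma return_of u a : x (bg a) <= u < x (sigma (bg a)) ->
  exists (r : nat) (j : int), [/\ (0 < r)%N,
    forall i, (0 < i < r)%N -> ~ Gamma (circle_pi L (u + i%:R * M))
    & u + r%:R * M = u - x (bg a) + x (sigma (en a)) + j%:~R * L].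
Proof.
move=> ua; have [_ recur _ _ graph] := fr.
pose v := u - x (bg a) + x (sigma (en a)).
have vE : x (sigma (en a)) <= v < x (en a).
  have := closed_widthE a x_closed; rewrite /width /v => E.
  by have /andP[? ?] := ua; apply/andP; split; lra.
have uU := beginning_in_unroll ua.
have vU : U v by have [c _ /beginning_in_unroll] := ending_to_beginning vE.
have : first_return_map (rotation M) Gamma (circle_pi L u) = circle_pi L v.
  have [G1 _] := graph u v uU vU; apply: G1; exists a; split.
  - by rewrite /beginning_interval /= in_itv.
  - by rewrite /ending_interval /= in_itv.
  - by rewrite /v; ring.
rewrite /first_return_map; case: pselect => [ex|[]]; last first.
  by apply: recur; case: uU.
case: ex_minnP => r /andP[r0 _] rmin; rewrite iter_rotation => /circle_piP[j E].
exists r, j; split=> // i /andP[i0 ir] Gi.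
have := rmin i; rewrite /returns_at i0 /= iter_rotation => /(_ (asboolT Gi)).
by rewrite leqNgt ir.
Qed.

(** The translation length determines the return time, because the rotation
    is irrational. *)
Lemma return_times : exists (r : A -> nat) (k : A -> int), forall a,
  [/\ (0 < r a)%N, x (sigma (en a)) = x (bg a) + (r a)%:R * M + (k a)%:~R * L
    & forall u i, x (bg a) <= u < x (sigma (bg a)) -> (0 < i < r a)%N ->
        ~ Gamma (circle_pi L (u + i%:R * M))].
Proof.
suff /choice[r /choice[k H]] : forall a, exists (r : nat) (k : int),
  [/\ (0 < r)%N, x (sigma (en a)) = x (bg a) + r%:R * M + k%:~R * L
    & forall u i, x (bg a) <= u < x (sigma (bg a)) -> (0 < i < r)%N ->
        ~ Gamma (circle_pi L (u + i%:R * M))].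
  by exists r, k.
move=> a; have a_in : x (bg a) <= x (bg a) < x (sigma (bg a)) by rewrite lexx x_up.
have [r [j [r0 _ E]]] := return_of a_in.
exists r, (- j); split=> //.
  rewrite E; rewrite intrN; ring.
move=> u i ua; have [r' [j' [r'0 inner E']]] := return_of ua.
suff -> : r = r' by exact: inner.
have : (r%:Z - r'%:Z)%:~R * M = (j - j')%:~R * L.
  by rewrite !intrB -!pmulrn; lra.
move/(irrational_integer_relation L_gt0 ML_irr)/eqP.
by rewrite subr_eq0 eqz_nat => /eqP.
Qed.

(** Consecutive points of a cycle of the dual scheme lie on one orbit of the
    rotation, so irrationality gives them integral positions along it. *)
Lemma dual_heights (r : A -> nat) (k : A -> int) :
  (forall a, x (sigma (en a)) = x (bg a) + (r a)%:R * M + (k a)%:~R * L) ->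
  exists (y j : doubled A -> int) (base : doubled A -> R),
    [/\ invariant_under (dual sigma) base,
        forall p, x p = base p + (y p)%:~R * M + (j p)%:~R * L,
        forall a, y (dual sigma (bg a)) - y (bg a) = r a
      & forall a, y (en a) - y (dual sigma (en a)) = r a].
Proof.
move=> xE; pose s := dual sigma.
have xE' a : x (en a) = x (sigma (bg a)) + (r a)%:R * M + (k a)%:~R * L.
  have := closed_heightE a x_closed; rewrite /height => E.
  by have := xE a; lra.
pose rel p q := exists y j : int, x q = x p + y%:~R * M + j%:~R * L.
have rels p : rel p (s p).
  case: p => a []; rewrite -/(en a) -/(bg a) /s ?dual_en ?dual_bg.
    exists (- (r a)%:Z), (- k a); rewrite xE' !intrN -pmulrn; ring.
  by exists (r a), (k a); rewrite xE pmulrn.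
have relp p q : q \in porbit s p -> rel p q.
  move=> /porbitP[i ->]; elim: i => [|i [y [j IH]]].
    by exists 0, 0; rewrite expg0 perm1; ring.
  have [y' [j' E]] := rels ((s ^+ i)%g p).
  by exists (y + y'), (j + j'); rewrite expgSr permM E IH !intrD; ring.
pose b p := odflt p [pick q in porbit s p].
have bP p : p \in porbit s (b p).
  rewrite /b; case: pickP => [q|/(_ p)]; last by rewrite porbit_id.
  by rewrite porbit_sym.
have bs p : b (s p) = b p.
  rewrite /b porbit_step; case: pickP => // /(_ p).
  by rewrite porbit_id.
have /choice[y /choice[j yj]] := fun p => relp _ _ (bP p).
have yr p q (n : nat) (l : int) : b p = b q ->
    x p = x q + n%:R * M + l%:~R * L -> y p - y q = n.
  move=> bpq; rewrite (yj p) (yj q) bpq => E.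
  have : (y p - y q - n%:Z)%:~R * M = (j q + l - j p)%:~R * L.
    by rewrite !intrB !intrD -pmulrn; lra.
  by move/(irrational_integer_relation L_gt0 ML_irr)/eqP; rewrite subr_eq0 => /eqP.
exists y, j, (x \o b); split=> //.
- by move=> p /=; rewrite bs.
- by move=> a; apply: (yr _ _ _ (k a)); rewrite ?bs// dual_bg xE.
- by move=> a; apply: (yr _ _ _ (k a)); rewrite ?bs// dual_en xE'.
Qed.

(** The return times are positive lengths for the dual, and the positions on
    the orbits are levels in the sense of [exchange_cycle_of_levels]. If two
    letters of a cycle crossed one level downwards, the points just left of
    their right ends would meet after [i] and [i'] steps, both before their
    first return; so they would coincide. *)
Lemma dual_exchange_scheme : exchange_scheme R (dual sigma).
Proof.
have [r [k rk]] := return_times.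
have r0 a : (0 < r a)%N by have [] := rk a.
have inner a u i : x (bg a) <= u < x (sigma (bg a)) -> (0 < i < r a)%N ->
    ~ Gamma (circle_pi L (u + i%:R * M)) by have [_ _] := rk a; apply.
have [|y [j [base [base_s xE yb ye]]]] := @dual_heights r k.
  by move=> a; have [] := rk a.
split.
  exists [ffun a => (r a)%:R]; split; last by move=> a; rewrite ffunE ltr0n.
  exists [ffun p => (y p)%:~R]; split.
    by move=> a; rewrite !ffunE -!intrB yb ye.
  by apply/ffunP => a; rewrite !ffunE -intrB yb pmulrn.
move=> C CP; apply: (@exchange_cycle_of_levels R A (dual sigma) (fun p => (y p)%:~R)) => //.
- by move=> a; rewrite ltr_int -subr_gt0 yb ltz_nat.
- by move=> a; rewrite ltr_int -subr_gt0 ye ltz_nat.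
move=> a b u aC bC.
have baseC p q : p \in C -> q \in C -> base p = base q.
  case/imsetP: CP => p0 _ ->.
  suff E p' : p' \in porbit (dual sigma) p0 -> base p' = base p0.
    by move=> /E -> /E ->.
  by move=> /porbitP[i ->]; elim: i => [|i IH]; rewrite ?expg0 ?perm1// expgSr permM base_s.
pose Y := Num.floor u.
have level c : (y (dual sigma (en c)))%:~R <= u < (y (en c))%:~R ->
    exists2 i : nat, (i < r c)%N & i%:Z = Y - y (dual sigma (en c)).
  rewrite -floor_ge_int -floor_lt_int -/Y => /andP[h1 h2].
  exists `|(Y - y (dual sigma (en c)))%R|%N; rewrite ?gez0_abs ?subr_ge0//.
  by rewrite -ltz_nat gez0_abs ?subr_ge0// -ye ltrD2r.
move=> /level[i ir iE] /level[i' i'r i'E].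
wlog le_ii' : a b i i' aC bC ir iE i'r i'E / (i <= i')%N.
  move=> W; case: (leqP i i') => [|/ltnW] h; first exact: (W a b i i').
  by apply/esym; apply: (W b a i' i).
have [e e0 [ea eb]] : exists2 e, 0 < e & e <= x (sigma (bg a)) - x (bg a) /\
    e <= x (sigma (bg b)) - x (bg b).
  exists (Num.min (x (sigma (bg a)) - x (bg a)) (x (sigma (bg b)) - x (bg b))).
    by rewrite lt_min !subr_gt0 !x_up.
  by rewrite !ge_min !lexx orbT.
have ua : x (bg a) <= x (sigma (bg a)) - e < x (sigma (bg a)).
  by apply/andP; split; lra.
have ub : x (bg b) <= x (sigma (bg b)) - e < x (sigma (bg b)).
  by apply/andP; split; lra.
have [l lE] : exists l : int, x (sigma (bg a)) - e =
    x (sigma (bg b)) - e + (i' - i)%N%:R * M + l%:~R * L.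
  exists (j (dual sigma (en a)) - j (dual sigma (en b))).
  have := xE (dual sigma (en a)); have := xE (dual sigma (en b)).
  rewrite !base_s (baseC _ _ aC bC) !dual_en.
  have -> : y (sigma (bg a)) = Y - i%:Z by rewrite -dual_en iE; ring.
  have -> : y (sigma (bg b)) = Y - i'%:Z by rewrite -dual_en i'E; ring.
  by rewrite natrB// !intrB -!pmulrn; lra.
have ii' : (i' - i)%N = 0%N.
  apply/eqP; rewrite -leqn0 leqNgt; apply/negP => lt.
  apply: (inner b _ (i' - i)%N ub).
    by rewrite lt (leq_ltn_trans _ i'r)// leq_subr.
  have [_ Ga] := beginning_in_unroll ua.
  suff <- : circle_pi L (x (sigma (bg a)) - e) =
     circle_pi L (x (sigma (bg b)) - e + (i' - i)%N%:R * M) by [].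
  by apply/circle_piP; exists l.
rewrite ii' mul0r addr0 in lE.
have E := unroll_mod (beginning_in_unroll ua) (beginning_in_unroll ub) lE.
by apply: (beginnings_disjoint ua); rewrite E.
Qed.

(** The segments with letters in an invariant family are invariant under the
    first return map, while a dense orbit visits all segments. *)
Lemma return_exchange_irreducible : irreducible_scheme sigma.
Proof.
move=> A0 inv; have [r [k rk]] := return_times.
have inner a u i : x (bg a) <= u < x (sigma (bg a)) -> (0 < i < r a)%N ->
    ~ Gamma (circle_pi L (u + i%:R * M)) by have [_ _] := rk a; apply.
have [->|[a aA0]] := set_0Vmem A0; first by left.
right; apply/setP => b; rewrite [RHS]inE.
have same p q : q \in porbit sigma p -> p.1 \in A0 -> q.1 \in A0.
  move=> /porbitP[i ->] pA0; elim: i => [|i IH]; first by rewrite expg0 perm1.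
  have : ((sigma ^+ i.+1)%g p) \in finset.setX A0 [set: bool]%SET.
    rewrite -inv expgSr permM imset_f//; case: ((sigma ^+ i)%g p) IH => c d.
    by rewrite finset.in_setX inE andbT.
  by case: ((sigma ^+ i.+1)%g p) => c d; rewrite finset.in_setX => /andP[].
have main n : forall a u, a \in A0 -> x (bg a) <= u < x (sigma (bg a)) ->
    forall b v (l : int), x (bg b) <= v < x (sigma (bg b)) ->
    v = u + n%:R * M + l%:~R * L -> b \in A0.
  elim/ltn_ind: n => n IH {aA0}a u aA0 ua {}b v l vb vE.
  case: (posnP n) => [n0|n0].
    have vu : v = u.
      apply: (unroll_mod (beginning_in_unroll vb) (beginning_in_unroll ua) (k := l)).
      by rewrite vE n0 mul0r addr0.
    by rewrite (beginnings_disjoint vb (b := a))// vu.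
  have [ra xa _] := rk a.
  have [lt|le] := ltnP n (r a).
    case: (inner a u n ua); first by rewrite n0.
    have [_] := beginning_in_unroll vb.
    by rewrite /= (_ : circle_pi L v = circle_pi L (u + n%:R * M))//; apply/circle_piP; exists l.
  pose u' := u - x (bg a) + x (sigma (en a)).
  have [|c cC u'c] := @ending_to_beginning a u'.
    have := closed_widthE a x_closed; rewrite /width /u' => E.
    by have /andP[? ?] := ua; apply/andP; split; lra.
  apply: (IH (n - r a)%N _ c u' _ u'c b v (l - k a)) => //.
  - by rewrite ltn_subrL ra.
  - exact: (same (en a) (bg c)).
  by rewrite vE /u' natrB// intrB xa; ring.
have a_in : x (bg a) <= x (bg a) < x (sigma (bg a)) by rewrite lexx x_up.
have [K /(_ (x (bg a)))[n [l [_ v_in]]]] := irrational_orbit_hits L_gt0 ML_irr (x_up b).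
exact: main aA0 a_in _ _ _ v_in erefl.
Qed.

End ReturnExchange.

(** * The scheme of two partitions *)

Section TwoPartitions.
Context (R : realType) (A : finType) (U : set R) (l l' d : A -> R).
Hypothesis d_gt0 : forall a, 0 < d a.
Hypothesis UE : forall u, U u <-> exists a, l a <= u < l a + d a.
Hypothesis l_inj : forall a b u,
  l a <= u < l a + d a -> l b <= u < l b + d b -> a = b.
Hypothesis UE' : forall u, U u <-> exists a, l' a <= u < l' a + d a.
Hypothesis l'_inj : forall a b u,
  l' a <= u < l' a + d a -> l' b <= u < l' b + d b -> a = b.

(** If [U] fills a left neighbourhood of [z], then one of the finitely many
    intervals covering [U] fills a smaller one. *)
Lemma left_germ (m : A -> R) (u z : R) :
  (forall t, U t -> exists a, m a <= t < m a + d a) ->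
  u < z -> (forall t, u <= t < z -> U t) -> exists a, m a < z <= m a + d a.
Proof.
move=> Um uz Ut.
have [a|v vz vP] := @finite_gap R A (fun a => if m a + d a < z then m a + d a else u) z.
  by case: ifP.
have t_in : u <= Num.max u v < z by rewrite le_max lexx gt_max uz vz.
have [a /andP[ta1 ta2]] := Um _ (Ut _ t_in).
have /andP[_ tz] := t_in.
exists a; rewrite (le_lt_trans ta1 tz) /= leNgt; apply/negP => lt.
have := vP a; rewrite lt => lt'.
by have := lt_trans ta2 lt'; rewrite ltNge le_max lexx orbT.
Qed.

Let in_l a : l a <= l a < l a + d a. Proof. by rewrite lexx ltrDl d_gt0. Qed.
Let in_l' a : l' a <= l' a < l' a + d a. Proof. by rewrite lexx ltrDl d_gt0. Qed.

Lemma right_end_outside a : (forall b, l b <> l a + d a) -> ~ U (l a + d a).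
Proof.
move=> none /UE[b /andP[ba ab]].
have lt : l b < l a + d a by rewrite lt_neqAle ba andbT; apply/eqP/none.
have := d_gt0 a => d0.
pose t := Num.max (l a) (l b).
have t1 : l a <= t by rewrite le_max lexx.
have t2 : l b <= t by rewrite le_max lexx orbT.
have t3 : t < l a + d a by rewrite gt_max lt ltrDl d0.
have E : a = b by apply: (@l_inj a b t); apply/andP; split=> //; apply: lt_trans ab.
by move: ab; rewrite E ltxx.
Qed.

Lemma right_end_matched a :
  (forall b, l b <> l a + d a) -> exists b, l' b + d b = l a + d a.
Proof.
move=> none; have := right_end_outside none => nU.
have [|||b /andP[b1 b2]] := @left_germ l' (l a) (l a + d a).
- by move=> t /UE'.
- by rewrite ltrDl.
- by move=> t ta; apply/UE; exists a.
exists b; apply/eqP; rewrite eq_le b2 andbT leNgt; apply/negP => lt.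
by apply: nU; apply/UE'; exists b; rewrite ltW.
Qed.

Lemma left_end_outside a : (forall b, l' b + d b <> l' a) ->
  forall u, u < l' a -> exists2 v, u <= v < l' a & ~ U v.
Proof.
move=> none u ua; apply: contrapT => no.
have [||b /andP[b1 b2]] := @left_germ l' u (l' a) _ ua.
- by move=> t /UE'.
- by move=> t ta; apply: contrapT => nU; apply: no; exists t.
have lt : l' a < l' b + d b.
  by rewrite lt_neqAle b2 andbT; apply/eqP => E; exact: (none b).
have E : a = b by apply: (@l'_inj a b (l' a)); rewrite ?in_l' ?lt ?ltW.
by move: b1; rewrite E ltxx.
Qed.

Lemma left_end_matched a :
  (forall b, l' b + d b <> l' a) -> exists b, l b = l' a.
Proof.
move=> none.
have /UE[b /andP[ba ab]] : U (l' a) by apply/UE'; exists a; exact: in_l'.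
exists b; apply/eqP; rewrite eq_le ba /= leNgt; apply/negP => lt.
have [v /andP[v1 v2]] := left_end_outside none lt.
by apply; apply/UE; exists b; rewrite v1 (lt_trans v2).
Qed.

Definition endpoint (p : doubled A) : R := if p.2 then l' p.1 + d p.1 else l p.1.

(** The scheme sends an end to the point where its interval stops, read in the
    same partition if another interval continues there, and in the other
    partition if this is an end of a segment. *)
Lemma successor_exists : exists s : {perm doubled A}, [/\
  forall a, endpoint (s (bg a)) = l a + d a,
  forall a, endpoint (s (en a)) = l' a,
  forall a b, s (bg a) = en b -> forall c, l c <> l a + d a
  & forall a b, s (en a) = bg b -> forall c, l' c + d c <> l' a].
Proof.
have /choice[f fP] (p : doubled A) : exists q,
    if p.2 then endpoint q = l' p.1 /\ (q.2 = false -> forall c, l' c + d c <> l' p.1)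
    else endpoint q = l p.1 + d p.1 /\ (q.2 = true -> forall c, l c <> l p.1 + d p.1).
  case: p => a [] /=.
    case: (pselect (exists c, l' c + d c = l' a)) => [[c E]|no]; first by exists (en c).
    have none c : l' c + d c <> l' a by move=> E; apply: no; exists c.
    by have [b bE] := left_end_matched none; exists (bg b).
  case: (pselect (exists c, l c = l a + d a)) => [[c E]|no]; first by exists (bg c).
  have none c : l c <> l a + d a by move=> E; apply: no; exists c.
  by have [b bE] := right_end_matched none; exists (en b).
have fb a := fP (bg a); have fe a := fP (en a); rewrite /= in fb fe.
(* At such a common value one partition would stop and the other start. *)
have mixed a b : f (bg a) <> f (en b).
  move=> E; have [E1 H1] := fb a; have [E2 H2] := fe b.
  have z : l' b = l a + d a by rewrite -E1 E E2.
  case Es : (f (bg a)) H1 E1 => [c []] H1 E1.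
    apply: (right_end_outside (H1 erefl)); rewrite -z.
    by apply/UE'; exists b; exact: in_l'.
  have none : forall c, l' c + d c <> l' b by apply: H2; rewrite -E Es.
  have [|v /andP[v1 v2]] := left_end_outside none (u := l a).
    by rewrite z ltrDl.
  by apply; apply/UE; exists a; rewrite v1 -z.
have f_inj : injective f.
  move=> [a []] [b []]; rewrite -?/(en _) -?/(bg _) => E.
  - have [E1 _] := fe a; have [E2 _] := fe b; congr en.
    apply: (@l'_inj a b (l' a)); first exact: in_l'.
    by rewrite -E1 E E2 in_l'.
  - by case: (mixed b a).
  - by case: (mixed a b).
  have [E1 _] := fb a; have [E2 _] := fb b; congr bg.
  have z : l a + d a = l b + d b by rewrite -E1 E E2.
  have := d_gt0 a; have := d_gt0 b => db da.
  apply: (@l_inj a b (Num.max (l a) (l b))).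
    by rewrite le_max lexx gt_max ltrDl da z ltrDl db.
  by rewrite le_max lexx orbT gt_max ltrDl db -z ltrDl da.
exists (perm f_inj); split.
- by move=> a; rewrite permE; have [] := fb a.
- by move=> a; rewrite permE; have [] := fe a.
- by move=> a b; rewrite permE => E; have [_] := fb a; apply; rewrite E.
- by move=> a b; rewrite permE => E; have [_] := fe a; apply; rewrite E.
Qed.

Lemma exchange_of_partitions : exists (sigma : {perm doubled A})
    (x : {ffun doubled A -> R}),
  [/\ interval_exchange sigma x,
    (forall C J, exchange_segment sigma x C J -> maximal_in (@half_open R) U J),
    (forall J, maximal_in (@half_open R) U J -> exists! C, exchange_segment sigma x C J)
  & [/\ forall a, x (bg a) = l a, forall a, x (sigma (bg a)) = l a + d a,
     forall a, x (sigma (en a)) = l' a & forall a, x (en a) = l' a + d a]].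
Proof.
have [s [sb se sbe seb]] := successor_exists.
pose x := [ffun p => endpoint p] : {ffun doubled A -> R}.
have xb a : x (bg a) = l a by rewrite ffunE.
have xe a : x (en a) = l' a + d a by rewrite ffunE.
have xsb a : x (s (bg a)) = l a + d a by rewrite ffunE sb.
have xse a : x (s (en a)) = l' a by rewrite ffunE se.
have x_up a : x (bg a) < x (s (bg a)) by rewrite xb xsb ltrDl.
have x_down a : x (s (en a)) < x (en a) by rewrite xe xse ltrDl.
have xa : allowed_endpoints s x by move=> a; rewrite xb xe xsb xse; ring.
have len a : lengths s x a = d a by rewrite ffunE xb xsb; ring.
have cyc : has_exchange_cycles s.
  move=> C; apply: (exchange_cycle_of_levels x_up x_down) => a b u _ _.
  by rewrite !xe !xse; exact: l'_inj.
have sch : exchange_scheme R s.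
  split=> //; exists (lengths s x); split; first by exists x.
  by move=> a; rewrite len.
have UEx u : U u <-> exists a, x (bg a) <= u < x (s (bg a)).
  by split=> [/UE[a ua]|[a ua]]; [|apply/UE]; exists a; move: ua; rewrite xb xsb.
have right_free b a : s (bg a) = en b -> ~ U (x (en b)).
  by move=> E; rewrite -E xsb; exact: (right_end_outside (sbe _ _ E)).
have left_free a b : s (en b) = bg a ->
    forall u, u < x (bg a) -> exists2 v, u <= v < x (bg a) & ~ U v.
  by move=> E; rewrite -E xse; exact: (left_end_outside (seb _ _ E)).
have left_inj a b : x (bg a) = x (bg b) -> a = b.
  by rewrite !xb => E; apply: (@l_inj a b (l a)); [exact: in_l|rewrite E; exact: in_l].
exists s, x; split=> //.
- by split=> // a; rewrite len.
- by move=> C J; exact: (exchange_segment_maximal x_up UEx right_free left_free).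
by move=> J; exact: (maximal_exchange_segment cyc x_up UEx right_free left_free left_inj).
Qed.

End TwoPartitions.

(** * First returns to unions of arcs *)

Section ReturnPartition.
Context (R : realType) (L M x0 : R) (Gamma : set (circle L)).
Context (A : finType) (l d : A -> R) (tau : A -> nat) (k : A -> int).
Hypothesis L_gt0 : 0 < L.
Hypothesis d_gt0 : forall a, 0 < d a.
Hypothesis UE : forall u, unroll Gamma x0 u <-> exists a, l a <= u < l a + d a.
Hypothesis l_inj : forall a b u,
  l a <= u < l a + d a -> l b <= u < l b + d b -> a = b.
Hypothesis tau_gt0 : forall a, (0 < tau a)%N.
Hypothesis tau_first : forall a u i, l a <= u < l a + d a -> (0 < i < tau a)%N ->
  ~ Gamma (circle_pi L (u + i%:R * M)).

Let l' a : R := l a + (tau a)%:R * M + (k a)%:~R * L.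

Hypothesis image_in : forall a u, l a <= u < l a + d a ->
  unroll Gamma x0 (u - l a + l' a).
Hypothesis returns_back : forall v, unroll Gamma x0 v ->
  exists n : nat, (0 < n)%N && `[< Gamma (circle_pi L (v - n%:R * M)) >].

Let unroll_itv u : unroll Gamma x0 u -> x0 <= u < x0 + L.
Proof. by case; rewrite /= in_itv. Qed.

Let same_point u v : unroll Gamma x0 u -> unroll Gamma x0 v ->
  circle_pi L u = circle_pi L v -> u = v.
Proof.
move=> /unroll_itv hu /unroll_itv hv /circle_piP[j E].
by rewrite E (fundamental_uniq L_gt0 hu hv E) mul0r addr0.
Qed.

Let image_pi a u : circle_pi L (u - l a + l' a) = circle_pi L (u + (tau a)%:R * M).
Proof. by apply/circle_piP; exists (k a); rewrite /l'; ring. Qed.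

(** The inverse of the first return map is the first return map of the inverse
    rotation. *)
Lemma images_cover v : unroll Gamma x0 v <-> exists a, l' a <= v < l' a + d a.
Proof.
split=> [vU|[a /andP[v1 v2]]]; last first.
  have -> : v = (v - l' a + l a) - l a + l' a by ring.
  by apply: image_in; apply/andP; split; lra.
case: (ex_minnP (returns_back vU)) => n /andP[n0 /asboolP Gn] nmin.
have [j u_in] := fundamental_shift x0 (v - n%:R * M) L_gt0.
set u := v - n%:R * M + j%:~R * L in u_in.
have uU : unroll Gamma x0 u.
  split; first by rewrite /= in_itv.
  by rewrite /= (_ : circle_pi L u = circle_pi L (v - n%:R * M))//; apply/circle_piP; exists j.
have /UE[a ua] := uU.
have tn : tau a = n.
  apply/eqP; rewrite eqn_leq; apply/andP; split; rewrite leqNgt; apply/negP => lt.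
    apply: (tau_first (i := n) ua); first by rewrite n0.
    have [_] := vU.
    rewrite /= (_ : circle_pi L v = circle_pi L (u + n%:R * M))//.
    by apply/circle_piP; exists (- j); rewrite /u intrN; ring.
  suff : (n <= n - tau a)%N by rewrite leqNgt ltn_subrL tau_gt0 n0.
  apply: nmin; rewrite subn_gt0 lt /=.
  apply/asboolP; have [_] := image_in ua; rewrite /= image_pi.
  rewrite (_ : circle_pi L (u + _) = circle_pi L (v - (n - tau a)%N%:R * M))//.
  by apply/circle_piP; exists j; rewrite /u natrB 1?ltnW//; ring.
exists a; have -> : v = u - l a + l' a.
  apply: same_point => //; first exact: image_in.
  by rewrite image_pi tn; apply/circle_piP; exists (- j); rewrite /u intrN; ring.
by have /andP[? ?] := ua; apply/andP; split; lra.
Qed.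

Lemma images_inj a b v : l' a <= v < l' a + d a -> l' b <= v < l' b + d b -> a = b.
Proof.
wlog le_ab : a b / (tau a <= tau b)%N => [W va vb|].
  by case: (leqP (tau a) (tau b)) => [|/ltnW] h; [apply: W|apply/esym/W].
move=> /andP[a1 a2] /andP[b1 b2].
pose u := v - l' a + l a; pose w := v - l' b + l b.
have ua : l a <= u < l a + d a by rewrite /u; apply/andP; split; lra.
have wb : l b <= w < l b + d b by rewrite /w; apply/andP; split; lra.
have uU : unroll Gamma x0 u by apply/UE; exists a.
have wU : unroll Gamma x0 w by apply/UE; exists b.
have E : circle_pi L u = circle_pi L (w + (tau b - tau a)%N%:R * M).
  by apply/circle_piP; exists (k b - k a); rewrite /u /w /l' natrB// intrB; ring.
case: (posnP (tau b - tau a)%N) => [t0|t0].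
  have uw : u = w by apply: same_point; rewrite // E t0 mul0r addr0.
  by apply: (l_inj ua); rewrite uw.
case: (tau_first (i := (tau b - tau a)%N) wb).
  by rewrite t0 ltn_subrL !tau_gt0.
by rewrite -E; have [] := uU.
Qed.

Lemma first_return_exchange : exists (sigma : {perm doubled A})
  (x : {ffun doubled A -> R}), first_return_is_exchange M Gamma x0 sigma x.
Proof.
have [s [x [ie seg1 seg2 [xb xsb xse xe]]]] :=
  exchange_of_partitions d_gt0 UE l_inj images_cover images_inj.
have returns a u : l a <= u < l a + d a ->
    returns_at (rotation M) Gamma (circle_pi L u) (tau a).
  move=> ua; rewrite /returns_at tau_gt0 /=; apply/asboolP.
  by rewrite iter_rotation -image_pi; have [] := image_in ua.
have mapE a u : l a <= u < l a + d a ->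
    first_return_map (rotation M) Gamma (circle_pi L u) = circle_pi L (u - l a + l' a).
  move=> ua; rewrite /first_return_map.
  case: pselect => [ex|[]]; last by exists (tau a); exact: returns ua.
  case: ex_minnP => n /andP[n0 /asboolP Gn] nmin.
  rewrite image_pi -iter_rotation; congr (iter _ _ _).
  apply/eqP; rewrite eqn_leq nmin ?returns//= leqNgt; apply/negP => lt.
  by apply: (tau_first (i := n) ua); rewrite ?n0// -iter_rotation.
exists s, x; split=> //.
  move=> p; have [t ->] := circle_pi_surj p => Gt.
  have [j t_in] := fundamental_shift x0 t L_gt0.
  have piE : circle_pi L t = circle_pi L (t + j%:~R * L).
    by apply/circle_piP; exists (- j); rewrite intrN; ring.
  have /UE[a ta] : unroll Gamma x0 (t + j%:~R * L).
    by split; [rewrite /= in_itv|rewrite /= -piE].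
  by exists (tau a); rewrite piE; exact: returns ta.
move=> y z yU zU; split.
  move=> [a []]; rewrite /beginning_interval /ending_interval /= !in_itv /=.
  rewrite xb xsb xse xe => ya za E; rewrite (mapE a y ya); congr circle_pi; lra.
have /UE[a ya] := yU; rewrite (mapE a y ya) => E.
have {}E : y - l a + l' a = z by apply: same_point => //; exact: image_in.
exists a; rewrite /beginning_interval /ending_interval /= !in_itv /=.
rewrite xb xsb xse xe -E; split=> //; last by ring.
by have /andP[? ?] := ya; apply/andP; split; lra.
Qed.

End ReturnPartition.

Section Cutting.
Context (R : realType).

Lemma next_cut (s : seq R) (p z : R) : p < z -> exists nx,
  [/\ p < nx, nx <= z, nx = z \/ nx \in s & forall q, q \in s -> p < q -> nx <= q].
Proof.
move=> pz; elim: s => [|q s [nx [p1 p2 p3 p4]]]; first by exists z; split=> //; left.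
case: (boolP (p < q < nx)) => [/andP[pq qn]|no].
  exists q; split=> //; first by rewrite ltW// (lt_le_trans qn).
    by right; rewrite mem_head.
  move=> r; rewrite inE => /predU1P[-> //|rs] pr.
  by rewrite ltW// (lt_le_trans qn) // p4.
exists nx; split=> //; first by case: p3 => [|h]; [left|right; rewrite inE h orbT].
move=> r; rewrite inE => /predU1P[->|rs] pr; last exact: p4.
by move: no; rewrite pr /= leNgt.
Qed.

Lemma previous_cut (s : seq R) (p0 u : R) : p0 \in s -> p0 <= u ->
  exists p, [/\ p \in s, p <= u & forall q, q \in s -> q <= u -> q <= p].
Proof.
elim: s p0 => [//|r s IH] p0 p0s p0u.
case: (pselect (exists2 q, q \in s & q <= u)) => [[q qs qu]|no].
  have [p [ps pu pmax]] := IH q qs qu.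
  case: (boolP (p < r <= u)) => [/andP[pr ru]|nr].
    exists r; split=> //; first exact: mem_head.
    move=> q'; rewrite inE => /predU1P[-> //|q's] q'u.
    by rewrite (le_trans (pmax _ q's q'u))// ltW.
  exists p; split=> //; first by rewrite inE ps orbT.
  move=> q'; rewrite inE => /predU1P[->|q's] q'u; last exact: pmax.
  by move: nr; rewrite q'u andbT -leNgt.
have only q : q \in r :: s -> q <= u -> q = r.
  by rewrite inE => /predU1P[//|qs] qu; case: no; exists q.
exists r; split; first exact: mem_head.
  by rewrite -(only _ p0s p0u).
by move=> q qs qu; rewrite (only _ qs qu).
Qed.

Context (L M : R) (Gamma : set (circle L)) (x0 : R).
Hypothesis L_gt0 : 0 < L.
Hypothesis ML_irr : irrational (M / L).
Hypothesis arcs : union_of_arcs Gamma.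

Definition congruent_to (E : seq R) (t : R) : Prop :=
  exists2 e, e \in E & circle_pi L t = circle_pi L e.

(** Membership in the union of arcs changes only at points congruent to an
    end of one of the arcs. *)
Lemma arcs_locally_constant : exists E : seq R, x0 \in E /\
  forall u v, u <= v -> (forall t, u < t <= v -> ~ congruent_to E t) ->
    Gamma (circle_pi L u) <-> Gamma (circle_pi L v).
Proof.
have [n [S [Sarc GE]]] := arcs.
have /choice[a /choice[b abP]] : forall i, exists a b, [/\ a < b, b <= a + L
    & S i = circle_pi L @` `[a, b[] by move=> i; exact: Sarc.
exists (x0 :: map a (enum 'I_n.+1) ++ map b (enum 'I_n.+1)); split; first exact: mem_head.
have aE i : a i \in x0 :: map a (enum 'I_n.+1) ++ map b (enum 'I_n.+1).
  by rewrite inE mem_cat map_f ?orbT// mem_enum.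
have bE i : b i \in x0 :: map a (enum 'I_n.+1) ++ map b (enum 'I_n.+1).
  by rewrite inE mem_cat (map_f b) ?orbT// mem_enum.
have GP t : Gamma (circle_pi L t) <-> exists i (j : int), a i <= t + j%:~R * L < b i.
  rewrite GE; split=> [[i _]|[i [j tj]]].
    have [_ _ ->] := abP i => -[w + /circle_piP[j wE]].
    by rewrite /= in_itv /= wE => h; exists i, j.
  exists i => //; have [_ _ ->] := abP i; exists (t + j%:~R * L); first by rewrite /= in_itv.
  by apply/circle_piP; exists j.
move=> u v uv cut; split=> /GP[i [j /andP[h1 h2]]]; apply/GP; exists i, j.
  rewrite (le_trans h1) ?lerD2r//= ltNge; apply/negP => le.
  apply: (cut (b i - j%:~R * L)); first by apply/andP; split; lra.
  by exists (b i) => //; apply/circle_piP; exists (- j); rewrite intrN; ring.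
rewrite (le_lt_trans _ h2) ?lerD2r// andbT leNgt; apply/negP => lt.
apply: (cut (a i - j%:~R * L)); first by apply/andP; split; lra.
by exists (a i) => //; apply/circle_piP; exists (- j); rewrite intrN; ring.
Qed.

Lemma arcs_contain : exists c d : R, c < d /\
  forall t, c <= t < d -> Gamma (circle_pi L t).
Proof.
have [n [S [Sarc GE]]] := arcs; have [a [b [ab _ SE]]] := Sarc ord0.
exists a, b; split=> // t tab; rewrite GE; exists ord0 => //.
by rewrite SE; exists t; rewrite //= in_itv.
Qed.

Lemma uniform_return : exists K : nat, forall u,
  exists2 n, (0 < n <= K)%N & Gamma (circle_pi L (u + n%:R * M)).
Proof.
have [c [d [cd Gcd]]] := arcs_contain.
have [K HK] := irrational_orbit_hits L_gt0 ML_irr cd.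
exists K => u; have [n [j [nK nj]]] := HK u; exists n => //.
rewrite (_ : circle_pi L _ = circle_pi L (u + n%:R * M + j%:~R * L)); first exact: Gcd.
by apply/circle_piP; exists (- j); rewrite intrN; ring.
Qed.

Lemma backward_return v :
  exists n : nat, (0 < n)%N && `[< Gamma (circle_pi L (v - n%:R * M)) >].
Proof.
have [c [d [cd Gcd]]] := arcs_contain.
have irrN : irrational (- M / L).
  move=> /rationalP[p [q E]]; apply: ML_irr; apply/rationalP.
  by exists (- p), q; rewrite -[M]opprK mulNr E intrN mulNr.
have [K HK] := irrational_orbit_hits L_gt0 irrN cd.
have [n [j [/andP[n0 _] nj]]] := HK v; exists n; rewrite n0 /=; apply/asboolP.
rewrite (_ : circle_pi L _ = circle_pi L (v + n%:R * - M + j%:~R * L)); first exact: Gcd.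
by apply/circle_piP; exists (- j); rewrite intrN; ring.
Qed.

(** Cut the segments at all points that reach an end of an arc, or [x0], within
    [K] steps, where [K] bounds the return times. Between two cuts the points
    travel together until they return. *)
Lemma first_return_of_arcs : exists (A : finType) (sigma : {perm doubled A})
    (x : {ffun doubled A -> R}),
  (0 < #|A|)%N /\ first_return_is_exchange M Gamma x0 sigma x.
Proof.
have [E [x0E Econst]] := arcs_locally_constant.
have [K HK] := uniform_return.
have /choice[sh shP] (t : R) : exists j : int, x0 <= t + j%:~R * L < x0 + L.
  exact: fundamental_shift.
pose rep t := t + (sh t)%:~R * L.
have repP t : x0 <= rep t < x0 + L := shP t.
have pi_rep t : circle_pi L (rep t) = circle_pi L t by apply/circle_piP; exists (sh t).
have pi_inj u v : x0 <= u < x0 + L -> x0 <= v < x0 + L ->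
    circle_pi L u = circle_pi L v -> u = v.
  move=> hu hv /circle_piP[j uE].
  by rewrite uE (fundamental_uniq L_gt0 hu hv uE) mul0r addr0.
have pi_shift u v t : circle_pi L u = circle_pi L v ->
    circle_pi L (u + t) = circle_pi L (v + t).
  by move=> h; rewrite !circle_piD h.
pose P := [seq rep (e - i%:R * M) | e <- E, i <- iota 0 K.+1].
have cutP t i : x0 <= t < x0 + L -> (i <= K)%N -> congruent_to E (t + i%:R * M) -> t \in P.
  move=> t_in iK [e eE te]; apply/allpairsP; exists (e, i); split; [exact: eE|by rewrite mem_iota|].
  rewrite /=; apply: pi_inj => //; rewrite pi_rep.
  by have := pi_shift _ _ (- (i%:R * M)) te; rewrite addrK.
have P_in p : p \in P -> x0 <= p < x0 + L.
  by move=> /allpairsP[[e i] [_ _ ->]]; exact: repP.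
have x0P : x0 \in P.
  apply: (@cutP _ 0%N); rewrite ?lexx ?ltrDl//.
  by exists x0; rewrite // mul0r addr0.
have /choice[nx nxP] (p : R) : exists q, p < x0 + L -> [/\ p < q, q <= x0 + L,
    q = x0 + L \/ q \in P & forall r, r \in P -> p < r -> q <= r].
  have [lt|ge] := ltP p (x0 + L); last by exists p.
  by have [q qP] := next_cut P lt; exists q.
have nocut p t : p \in P -> p < t < nx p -> t \notin P.
  move=> pP /andP[pt tn]; apply/negP => tP.
  have /andP[_ /nxP[_ _ _ /(_ _ tP pt)]] := P_in p pP.
  by rewrite leNgt tn.
(* Points of a piece meet the arcs at the same times. *)
have moves p u i : p \in P -> p <= u < nx p -> (i <= K)%N ->
    Gamma (circle_pi L (p + i%:R * M)) <-> Gamma (circle_pi L (u + i%:R * M)).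
  move=> pP /andP[pu un] iK; apply: Econst => [|t /andP[t1 t2]]; first by rewrite lerD2r.
  have /andP[p1 /nxP[_ nL _ _]] := P_in p pP.
  pose s := t - i%:R * M => cg.
  have sp : p < s < nx p by rewrite /s; apply/andP; split; lra.
  apply: (negP (nocut p s pP sp)).
  apply: (@cutP _ i) => //; last by rewrite /s subrK.
  by have /andP[? ?] := sp; apply/andP; split; lra.
pose B := [seq p <- P | `[< Gamma (circle_pi L p) >]].
have BP p : p \in B -> p \in P /\ Gamma (circle_pi L p).
  by rewrite mem_filter => /andP[/asboolP].
pose A : finType := seq_sub B.
pose l (a : A) : R := ssval a.
pose d a := nx (l a) - l a.
have lB a : l a \in P /\ Gamma (circle_pi L (l a)) by apply: BP; exact: ssvalP.
have ldE a : l a + d a = nx (l a) by rewrite /d; ring.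
have lin a : l a < x0 + L by have /andP[] := P_in _ (lB a).1.
have /choice[tau tauP] (a : A) : exists n : nat, [/\ (0 < n <= K)%N,
    Gamma (circle_pi L (l a + n%:R * M)) & forall i, (0 < i < n)%N ->
    ~ Gamma (circle_pi L (l a + i%:R * M))].
  have ex : exists n, (0 < n <= K)%N && `[< Gamma (circle_pi L (l a + n%:R * M)) >].
    by have [n nK Gn] := HK (l a); exists n; rewrite nK; apply/asboolP.
  case: (ex_minnP ex) => n /andP[nK /asboolP Gn] nmin.
  exists n; split=> // i /andP[i0 ilt] Gi.
  suff : (n <= i)%N by rewrite leqNgt ilt.
  have /andP[_ nK'] := nK.
  by apply: nmin; rewrite i0 (leq_trans (ltnW ilt) nK') /=; apply/asboolP.
pose k a := sh (l a + (tau a)%:R * M).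
have UE u : unroll Gamma x0 u <-> exists a, l a <= u < l a + d a.
  split=> [[]|[a]].
    rewrite /= in_itv /= => u_in Gu; have /andP[u0 uL] := u_in.
    have [p [pP pu pmax]] := previous_cut x0P u0.
    have /andP[_ pL] := P_in p pP; have [pn nL nor _] := nxP _ pL.
    have un : u < nx p.
      rewrite ltNge; apply/negP => le.
      case: nor => [e|nP]; first by move: uL; rewrite -e ltNge le.
      by have := pmax _ nP le; rewrite leNgt pn.
    have pB : p \in B.
      rewrite mem_filter pP andbT; apply/asboolP.
      have := @moves p u 0%N pP _ isT; rewrite !mul0r !addr0 pu un => /(_ isT) [_]; exact.
    by exists (SeqSub pB); rewrite ldE /l /= pu.
  rewrite ldE => /andP[au un]; have [aP Ga] := lB a.
  have [_ nL _ _] := nxP _ (lin a); have /andP[a0 _] := P_in _ aP.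
  split; first by rewrite /= in_itv /= (le_trans a0 au) (lt_le_trans un nL).
  have := @moves (l a) u 0%N aP _ isT; rewrite !mul0r !addr0 au un.
  by move=> /(_ isT) [+ _]; apply.
have l_inj a b u : l a <= u < l a + d a -> l b <= u < l b + d b -> a = b.
  rewrite !ldE => /andP[a1 a2] /andP[b1 b2]; apply: val_inj; rewrite /= -/(l a) -/(l b).
  have [lt|lt|//] := ltgtP (l a) (l b).
    have [_ _ _ /(_ _ (lB b).1 lt)] := nxP _ (lin a).
    by move=> h; have := lt_le_trans a2 (le_trans h b1); rewrite ltxx.
  have [_ _ _ /(_ _ (lB a).1 lt)] := nxP _ (lin b).
  by move=> h; have := lt_le_trans b2 (le_trans h a1); rewrite ltxx.
have d0 a : 0 < d a by have [h _ _ _] := nxP _ (lin a); rewrite subr_gt0.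
have A0 : (0 < #|A|)%N.
  have [c [e [ce Gce]]] := arcs_contain.
  have /UE[a _] : unroll Gamma x0 (rep c).
    by split; [rewrite /= in_itv; exact: repP|rewrite /= pi_rep; apply: Gce; rewrite lexx].
  by apply/card_gt0P; exists a.
exists A.
have [||||s [x fr]] :=
  @first_return_exchange R L M x0 Gamma A l d tau k L_gt0 d0 UE l_inj; last first.
- by exists s, x.
- by move=> v _; exact: backward_return.
- move=> a u; rewrite ldE => ua; have [aP _] := lB a.
  have [/andP[t0 tK] Gt _] := tauP a.
  have -> : l a + (tau a)%:R * M + (k a)%:~R * L = rep (l a + (tau a)%:R * M) by [].
  set r := rep _; have /andP[r1 r2] : x0 <= r < x0 + L by exact: repP.
  have /andP[au un] := ua.
  have G' : Gamma (circle_pi L (u - l a + r)).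
    rewrite (_ : circle_pi L _ = circle_pi L (u + (tau a)%:R * M)).
      by have [h _] := moves _ _ _ aP ua tK; exact: h.
    by apply/circle_piP; exists (k a); rewrite /r /rep -/(k a); ring.
  split=> //; rewrite /= in_itv /=; apply/andP; split; first lra.
  rewrite ltNge; apply/negP => le.
  (* Otherwise a point of the piece reaches [x0], which is a cut. *)
  pose t := x0 + L - (k a)%:~R * L - (tau a)%:R * M.
  have rE : r = l a + (tau a)%:R * M + (k a)%:~R * L by [].
  have tin : l a < t < nx (l a) by rewrite /t; apply/andP; split; lra.
  apply: (negP (nocut _ _ aP tin)).
  have [_ nL _ _] := nxP _ (lin a); have /andP[a0 _] := P_in _ aP.
  apply: (@cutP _ (tau a)) => //.
    by have /andP[? ?] := tin; apply/andP; split; lra.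
  exists x0 => //; apply/circle_piP; exists (1 - k a).
  by rewrite /t intrB; ring.
- move=> a u i; rewrite ldE => ua /andP[i0 it] Gi.
  have [/andP[_ tK] _ /(_ i)] := tauP a; rewrite i0 it => /(_ isT); apply.
  have [_ h] := moves _ _ i (lB a).1 ua (ltnW (leq_trans it tK)); exact: h.
- by move=> a; have [/andP[]] := tauP a.
Qed.

End Cutting.

Theorem theorem1 (R : realType) :
  (forall (L M : R), 0 < L -> irrational (M / L) ->
   forall Gamma : set (circle L), union_of_arcs Gamma ->
   forall x0 : R, admissible Gamma x0 ->
   exists (A : finType) (sigma : {perm doubled A})
          (x : {ffun doubled A -> R}),
     [/\ (0 < #|A|)%N, irreducible_scheme sigma, rotational_scheme R sigma
       & first_return_is_exchange M Gamma x0 sigma x])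
  /\
  (forall (A : finType) (sigma : {perm doubled A})
          (x : {ffun doubled A -> R}),
   (0 < #|A|)%N -> interval_exchange sigma x ->
   irreducible_scheme sigma -> rotational_scheme R sigma ->
   exists (L M : R) (Gamma : set (circle L)) (x0 : R),
     [/\ 0 < L, union_of_arcs Gamma, admissible Gamma x0
       & exists (sigma' : {perm doubled A}) (x' : {ffun doubled A -> R}),
           first_return_is_exchange M Gamma x0 sigma' x' /\
           shift_equivalent sigma' x' sigma x])
  /\
  (forall (A : finType) (sigma : {perm doubled A}),
   (0 < #|A|)%N -> exchange_scheme R sigma -> irreducible_scheme sigma ->
   (rotational_scheme R sigma <->
    exists (L M : R) (Gamma : set (circle L)) (x0 : R),
      [/\ 0 < L, irrational (M / L), union_of_arcs Gamma, admissible Gamma x0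
        & exists x : {ffun doubled A -> R},
            first_return_is_exchange M Gamma x0 sigma x])).
Proof.
split=> [L M L0 irr Gamma arcs x0 _|].
  have [A [sigma [x [A0 fr]]]] := first_return_of_arcs x0 L0 irr arcs.
  exists A, sigma, x; split=> //; first exact: (return_exchange_irreducible L0 irr fr).
  by split; [have [[]] := fr|exact: (dual_exchange_scheme L0 irr fr)].
split=> [A sigma x A0 ie irr rot|A sigma A0 sch irr].
  have [L [M [Gamma [x0 [x' [L0 arcs adm fr len]]]]]] :=
    rotational_realization A0 ie irr rot.
  by exists L, M, Gamma, x0; split=> //; exists sigma, x'.
split=> [|[L [M [Gamma [x0 [L0 MLirr _ _ [x fr]]]]]]].
  exact: rotational_irrational_realization.
by split=> //; exact: (dual_exchange_scheme L0 MLirr fr).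
Qed.
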